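(* Let $\theta^*\in(-1,1]$, $y_0=0$, and $y_i=\theta^*y_{i-1}+\epsilon_i$ for $i\ge 1$, where $\{\epsilon_i\}_{i\ge1}$ are i.i.d. standard normal random variables. Let $\hat\theta_{\mathrm{OD}}$ be the (scalar) online debiasing estimator described in the context, computed from $y_0,\dots,y_n$ with the tuning parameters $$\gamma_n=\frac{1}{(\log n)\cdot\log\log(n)},\qquad \Gamma_{i,n}=\max\Big\{(\log n)^2y_{i-1}^2,\ \sum_{j=1}^{i-1}y_j^2\Big\}.$$ Then, as $n\to\infty$, $$\sqrt{\frac{\sum_{i=1}^n y_{i-1}^2}{(\log n)\cdot\log\log(n)}}\ \big(\hat\theta_{\mathrm{OD}}-\theta^*\big)\ \longrightarrow\ \mathcal{N}(0,1)\quad\text{in distribution.}$$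
   Context: The autoregression is viewed as a one-dimensional linear regression with covariates $x_i=y_{i-1}$ and responses $y_i$. Put $S_n=\sum_{i=1}^n y_{i-1}^2$ and $\hat\theta_{\mathrm{LS}}=S_n^{-1}\sum_{i=1}^n y_{i-1}y_i$. With $z_i=\Gamma_{i,n}^{-1/2}y_{i-1}$ (and $z_1=0$, since $y_0=0$ and $\Gamma_{1,n}=0$), define recursively $w_i=\big(1-\sum_{j=1}^{i-1}w_jz_j\big)z_i\big/(\gamma_n/2+z_i^2)$ for $i=1,\dots,n$. The online debiasing estimator is $\hat\theta_{\mathrm{OD}}=\hat\theta_{\mathrm{LS}}+S_n^{-1/2}\sum_{i=1}^n w_i\,(y_i-y_{i-1}\hat\theta_{\mathrm{LS}})$. *)

(* Defs.v *)
From HB Require Import structures.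
From mathcomp Require Import all_boot all_order all_algebra.
From mathcomp Require Import finmap.
From mathcomp Require Import all_classical all_reals all_analysis.

Set Implicit Arguments.
Unset Strict Implicit.
Unset Printing Implicit Defensive.

Import Order.TTheory GRing.Theory Num.Theory.
Import numFieldNormedType.Exports.

Local Open Scope classical_set_scope.
Local Open Scope ring_scope.

Section probability_notions.
Context d (T : measurableType d) (R : realType) (P : probability T R).

Definition mutually_independent (I : choiceType) (D : set I)
    (X : I -> {RV P >-> R}) : Prop :=
  forall (J : {fset I}) (A : I -> set R),
    [set` J] `<=` D -> (forall i, i \in J -> measurable (A i)) ->
    (P (\bigcap_(i in [set` J]) (X i @^-1` A i))
       = \prod_(i <- J) P (X i @^-1` A i))%E.

(* The laws are compared on Borel sets only: measures are total functions on
   [set R], and their values on non-measurable sets carry no meaning. *)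
Definition has_law (X : {RV P >-> R}) (mu : probability (measurableTypeR R) R) : Prop :=
  forall A : set R, measurable A -> distribution P X A = mu A.

(* Convergence in distribution of real random variables: the distribution
   functions converge at every continuity point of the limiting one. *)
Definition cvg_in_distribution (X : nat -> T -> R) (mu : probability (measurableTypeR R) R) :
    Prop :=
  (forall n, measurable_fun [set: T] (X n)) /\
  forall r : R, {for r, continuous (fun x : R => mu `]-oo, x]%classic)} ->
    pushforward P (X n) `]-oo, r]%classic @[n --> \oo] --> mu `]-oo, r]%classic.

End probability_notions.

Section online_debiasing.
Context (R : realType).
Implicit Types (y z Gamma : nat -> R) (gamma : R) (n i : nat).

(* [y] is one trajectory y_0, y_1, ... of the series; the i-th covariate is
   y_(i-1), written [y i.-1], and the indices i, j start at 1. *)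
Definition gram y n : R := \sum_(1 <= i < n.+1) y i.-1 ^+ 2.

Definition theta_LS y n : R :=
  (gram y n)^-1 * \sum_(1 <= i < n.+1) y i.-1 * y i.

(* When Gamma i = 0 this is 0, because 0^-1 = 0; this is the convention
   z_1 = 0. *)
Definition od_z Gamma y i : R := (Num.sqrt (Gamma i))^-1 * y i.-1.

(* [od_wz gamma z i] is the partial sum w_1 z_1 + ... + w_i z_i. The recursion
   that defines the weights is [od_wE]. *)
Fixpoint od_wz gamma z i : R :=
  if i is k.+1 then
    od_wz gamma z k
    + ((1 - od_wz gamma z k) * z i / (gamma / 2 + z i ^+ 2)) * z i
  else 0.

Definition od_w gamma z i : R :=
  (1 - od_wz gamma z i.-1) * z i / (gamma / 2 + z i ^+ 2).

Lemma od_wE gamma z i : (0 < i)%N ->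
  od_w gamma z i =
  (1 - \sum_(1 <= j < i) od_w gamma z j * z j) * z i
    / (gamma / 2 + z i ^+ 2).
Proof.
case: i => // i _; rewrite /od_w /=; congr ((1 - _) * _ / _).
elim: i => [|i IH]; first by rewrite big_geq.
by rewrite big_nat_recr //= -IH.
Qed.

Definition theta_OD gamma Gamma y n : R :=
  theta_LS y n
  + (Num.sqrt (gram y n))^-1
    * \sum_(1 <= i < n.+1)
        od_w gamma (od_z Gamma y) i * (y i - y i.-1 * theta_LS y n).

Definition log_loglog n : R := ln n%:R * ln (ln n%:R).

Definition od_gamma n : R := (log_loglog n)^-1.

Definition od_Gamma y n i : R :=
  Num.max (ln n%:R ^+ 2 * y i.-1 ^+ 2) (\sum_(1 <= j < i) y j ^+ 2).

End online_debiasing.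

Arguments log_loglog R n : clear implicits.
Arguments od_gamma R n : clear implicits.

(* Main.v *)
Require Import Defs.
From HB Require Import structures.
From mathcomp Require Import all_boot all_order all_algebra.
From mathcomp Require Import finmap.
From mathcomp Require Import all_classical all_reals all_analysis.
From mathcomp Require Import measurable_realfun.
From mathcomp Require Import ring lra zify.
Import Order.TTheory GRing.Theory Num.Theory.
Import numFieldNormedType.Exports.
Local Open Scope classical_set_scope.
Local Open Scope ring_scope.

(** Write [S] for the Gram sum [gram y n], [L] for [ln n * ln (ln n)], [gamma]
for [1 / L] and [M] for the sum of the [y_(i-1) eps_i]. Inserting the recursion
of the series in the estimator gives ([od_errorE])

  sqrt (S / L) (theta_OD - theta) = sum_i a_i eps_i + sqrt gamma (M / sqrt S) k,

where [a_i = sqrt gamma * w_i] and [k = 1 - S^(-1/2) sum_i w_i y_(i-1)]. The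
first term carries the limit law, the second one is a bias that vanishes.

The first term. The residuals [r_i = 1 - sum_(j <= i) w_j z_j] satisfy
[r_(i-1)^2 - r_i^2 = w_i^2 (gamma + z_i^2)], so that the sum of the [a_i^2] is
smaller than 1 along every trajectory, and it differs from 1 by at most
[r_n^2 + 1 / (gamma (ln n)^2)] because [z_i^2 <= 1 / (ln n)^2]. The weights are
predictable and the noise is exactly Gaussian, so adding one more independent
term with the missing variance,

  sum_i a_i eps_i + sqrt (1 - sum_i a_i^2) eps_(n+1),

yields a variable whose law is exactly N(0,1), for every [n] that is large
enough for [gamma] to be positive ([predictable_gaussian_sum]). The theorem
follows once the rescaled error and this proxy are shown to differ by a quantity
that tends to 0 in probability ([debiased_error_approx]), since such a
perturbation does not change a limit law ([cvg_in_distribution_approx]).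

The bias. The increments of [M^2 / (1 + S)] have means at most a constant times
those of [y_(i-1)^2 / (1 + S_i)], where [S_i = gram y i], and the latter
variables add up to at most [ln (1 + S)]. Hence the mean of
[M^2 / (1 + S)] is [O(ln n)], whether the series is stationary or not
([mean_self_normalized]). Divided by [L] it is [O(1 / ln (ln n))]: this is where
the iterated logarithm in [gamma] is used.

The good event. On the event where [S >= 1] and [(ln n)^2 y_(i-1)^2 <= S / 2]
for all [i <= n], every [Gamma_i] is at most [S], which puts [k] in [0, 1]
([od_shrinkage_bound]), and the [z_i^2] add up to at least 1/2, which forces
[r_n <= gamma] ([od_residual_le_gamma]). The complement has small probability
([bad_event_small]): exponential moments of [y_i^2] bound the largest of the
[y_i^2] by a multiple of the variance times [ln n] ([tail_y]), and the Laplace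
transform of [S], which an exact recursion computes, bounds the probability that
[S] is small ([small_ball_gram]). When [theta] is in (-1, 1) the variance is
bounded while [S >= n / ln n] with high probability; when [theta = 1] the
variance is of order [n] while [S >= (n / ln n)^2] with high probability. *)

Set Implicit Arguments.
Unset Strict Implicit.
Unset Printing Implicit Defensive.

(** * Events determined by the past noise *)

Section adapted.
Context d (T : measurableType d) (R : realType) (P : probability T R).
Variable eps : nat -> {RV P >-> R}.

(** The generating pi-system is that of the cylinders over [eps 1], ..., [eps n];
a coordinate is left free by taking the full set for it. *)
Definition past n : set (set T) :=
  [set C | exists2 B : nat -> set R, (forall i, measurable (B i)) &
    C = \bigcap_(i in [set i | (1 <= i <= n)%N]) (eps i @^-1` B i)].

(** Measurability for the sigma-algebra of the past is measurability on the type
[T] equipped with that sigma-algebra, so that all closure properties of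
measurable functions apply to adapted ones. *)
Definition adapted n d' (V : measurableType d') (f : T -> V) :=
  measurable_fun [set: g_sigma_algebraType (past n)]
    (f : g_sigma_algebraType (past n) -> V).

Lemma past_measurable n : past n `<=` measurable.
Proof.
move=> _ [B mB ->]; apply: fin_bigcap_measurable => [|i _].
  by apply: (@sub_finite_set _ _ `I_n.+1) => // i /= /andP[].
by rewrite -[X in measurable X]setTI; exact: measurable_funP.
Qed.

Lemma past_setI n : setI_closed (past n).
Proof.
move=> _ _ [B mB ->] [C mC ->]; exists (fun i => B i `&` C i).
  by move=> i; exact: measurableI.
by rewrite -bigcapI.
Qed.

Lemma past_setT n : past n setT.
Proof.
by exists (fun=> setT) => //; apply/seteqP; split.
Qed.

Lemma past_le m n : (m <= n)%N -> past m `<=` past n.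
Proof.
move=> mn _ [B mB ->]; exists (fun i => if (i <= m)%N then B i else setT).
  by move=> i; case: ifP.
apply/seteqP; split=> t /= H i /= /andP[i1 im].
  by case: ifP => // im'; apply: H => /=; rewrite i1.
by have := H i; rewrite /= i1 im (leq_trans im mn); exact.
Qed.

Lemma adapted_le m n d' (V : measurableType d') (f : T -> V) :
  (m <= n)%N -> adapted m f -> adapted n f.
Proof.
move=> mn mf _ A mA; have := mf measurableT A mA.
exact: (@sub_sigma_algebra2 _ setT _ _ (past_le mn)).
Qed.

Lemma adapted_measurable n d' (V : measurableType d') (f : T -> V) :
  adapted n f -> measurable_fun setT f.
Proof.
move=> mf _ A mA; have := mf measurableT A mA.
exact: (smallest_sub (@sigma_algebra_measurable _ T) (@past_measurable n)).
Qed.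

Lemma adapted_eps n i : (1 <= i <= n)%N -> adapted n (eps i).
Proof.
move=> i1n _ A mA; apply: sub_sigma_algebra.
exists (fun j => if j == i then A else setT) => [j|]; first by case: ifP.
rewrite setTI; apply/seteqP; split=> t /=.
  by move=> At j _ /=; case: eqP => [->|].
by move=> /(_ i i1n) /=; rewrite eqxx.
Qed.

Variable nu : probability (measurableTypeR R) R.
Hypothesis eps_indep : mutually_independent [set i : nat | (1 <= i)%N] eps.
Hypothesis eps_law : forall i, (1 <= i)%N -> has_law (eps i) nu.

(** On a cylinder this is mutual independence applied to the coordinates up to
[n] and up to [n.+1]; two finite measures that agree on a pi-system agree on the
sigma-algebra that it generates. *)
Lemma past_indep n E B : <<s past n >> E -> measurable B ->
  (P (E `&` eps n.+1 @^-1` B) = P E * nu B)%E.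
Proof.
move=> sE mB.
have mepsB : measurable (eps n.+1 @^-1` B).
  by rewrite -[X in measurable X]setTI; exact: measurable_funP.
have nuB : nu B = P (eps n.+1 @^-1` B) by rewrite -(eps_law (ltn0Sn n) mB).
pose k : {nonneg R} := NngNum (fine_ge0 (measure_ge0 P (eps n.+1 @^-1` B))).
have kE : (k%:num%:E = P (eps n.+1 @^-1` B))%E by rewrite fineK// fin_num_measure.
transitivity (mrestr P mepsB E) => //.
have scaleE F :
    (mscale k P : {measure set T -> \bar R}) F = (P F * nu B)%E.
  by rewrite nuB -kE muleC.
rewrite -scaleE.
apply: (g_sigma_algebra_measure_unique (past n) (@past_measurable n)
  (fun=> setT)) => //.
- by move=> _; exact: past_setT.
- by rewrite bigcup_const.
- exact: past_setI.
- move=> _ [C mC ->]; rewrite [RHS]scaleE /= /mrestr.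
  pose J m : {fset nat} := [fset i in iota 1 m]%fset.
  have inJ m i : (i \in J m) = (1 <= i <= m)%N.
    by rewrite !inE/= mem_iota add1n ltnS.
  have setJ m : [set` J m] = [set i | (1 <= i <= m)%N].
    by apply/seteqP; split=> i /=; rewrite inJ.
  have J1 m : J m.+1 = (m.+1 |` J m)%fset.
    apply/fsetP => i; rewrite in_fset1U !inJ.
    by have [->|] := eqVneq i m.+1; rewrite ?ltnS ?leqnn//= => ?; lia.
  rewrite -setJ.
  have sJ m : [set` J m] `<=` [set i | (1 <= i)%N].
    by rewrite setJ => i /= /andP[].
  rewrite (eps_indep (sJ n) (fun i _ => mC i)).
  pose C' i := if i == n.+1 then B else C i.
  have C'J i : i \in J n -> C' i = C i.
    by rewrite inJ /C' => /andP[_ ile]; rewrite ltn_eqF.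
  have -> : \bigcap_(i in [set` J n]) (eps i @^-1` C i) `&` eps n.+1 @^-1` B =
      \bigcap_(i in [set` J n.+1]) (eps i @^-1` C' i).
    rewrite J1 set_fsetU1 bigcap_setU1 setIC; congr (_ `&` _).
      by rewrite /C' eqxx.
    by apply: eq_bigcapr => i /= iJ; rewrite C'J.
  rewrite (eps_indep (sJ n.+1)); last first.
    by move=> i _; rewrite /C'; case: ifP.
  rewrite J1 big_fsetU1/=; last by rewrite inJ ltnn andbF.
  rewrite /C' eqxx muleC nuB; congr (_ * _)%E.
  by apply: eq_big_seq => i iJ; rewrite -/(C' i) C'J.
- by move=> _; rewrite /= /mrestr setTI ltey_eq fin_num_measure.
Qed.

(** The new noise can be integrated out first, with everything that depends on the
past frozen: by independence the joint law of [U] and [eps n.+1] is a product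
measure. All conditional expectations given the past are taken through this
formula. *)
Lemma adapted_fubini n d' (V : measurableType d') (U : T -> V)
    (h : V * measurableTypeR R -> \bar R) :
  adapted n U -> measurable_fun setT h -> (forall z, 0 <= h z)%E ->
  (\int[P]_t h (U t, eps n.+1 t) = \int[P]_t \int[nu]_x h (U t, x))%E.
Proof.
move=> aU mh h0; have mU := adapted_measurable aU.
have meps : measurable_fun setT (eps n.+1 : T -> measurableTypeR R).
  by move=> _ A mA; exact: (measurable_funPT (eps n.+1)).
pose UX t : V * measurableTypeR R := (U t, eps n.+1 t).
have mUX : measurable_fun setT UX by exact/measurable_fun_pair.
pose U' : {RV P >-> V} := mfun_Sub (mem_set mU).
pose UX' : {RV P >-> (V * measurableTypeR R)%type} := mfun_Sub (mem_set mUX).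
rewrite -[LHS](ge0_integral_distribution UX' mh h0).
transitivity (\int[distribution P U' \x nu]_z h z)%E.
  apply: (eq_measure_integral (distribution P U' \x nu)%E) => A mA _.
  apply/esym; apply: product_measure_unique => // A1 A2 mA1 mA2 /=.
  transitivity (P (U @^-1` A1 `&` eps n.+1 @^-1` A2)) => //.
  rewrite past_indep//.
  by have := aU measurableT A1 mA1; rewrite setTI.
rewrite fubini_tonelli1//= ge0_integral_distribution//.
- exact: measurable_fun_fubini_tonelli_F.
- by move=> v; exact: integral_ge0.
Qed.

End adapted.

(** * Gaussian integrals *)

Section gaussian.
Context (R : realType).
Local Notation mu := (@lebesgue_measure R).
Local Notation N01 := (normal_prob (0 : R) (1 : R)).

Section density.
Variables (m s : R).

Import HBNNSimple.

Let mpdf : measurable_fun setT (fun x => (normal_pdf m s x)%:E).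
Proof. by apply/measurable_EFinP; exact: measurable_normal_pdf. Qed.

Let pdf0 x : (0 <= (normal_pdf m s x)%:E)%E.
Proof. by rewrite lee_fin normal_pdf_ge0. Qed.

Let integral_normal_indic E : measurable E ->
  (\int[normal_prob m s]_x (\1_E x)%:E =
   \int[mu]_x ((\1_E x)%:E * (normal_pdf m s x)%:E))%E.
Proof.
move=> mE; rewrite integral_indic//= /normal_prob setIT [LHS]integral_mkcond.
apply: eq_integral => x _; rewrite patchE indicE.
by case: (x \in E); rewrite ?mul1e ?mul0e.
Qed.

Let integral_normal_nnsfun (f : {nnsfun (measurableTypeR R) >-> R}) :
  (\int[normal_prob m s]_x (f x)%:E =
   \int[mu]_x ((f x)%:E * (normal_pdf m s x)%:E))%E.
Proof.
under [LHS]eq_integral do rewrite fimfunE -fsumEFin//.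
rewrite [LHS]ge0_integral_fsum//; last 2 first.
  - by move=> r; exact/measurable_EFinP/measurableT_comp.
  - by move=> n x _; rewrite EFinM nnfun_muleindic_ge0.
under [RHS]eq_integral.
  move=> x xD; rewrite fimfunE -fsumEFin// ge0_mule_fsuml; last first.
    by move=> r; rewrite EFinM nnfun_muleindic_ge0.
  over.
rewrite [RHS]ge0_integral_fsum//; last 2 first.
  - move=> r; apply: emeasurable_funM => //.
    exact/measurable_EFinP/measurableT_comp.
  - by move=> n x _; rewrite EFinM mule_ge0// nnfun_muleindic_ge0.
apply: eq_fsbigr => r _.
rewrite integralZl_indic_nnsfun// integral_normal_indic//.
have [r0|r0] := leP 0 r.
  rewrite -ge0_integralZl//.
  - by apply: eq_integral => x _; rewrite EFinM muleA.
  - by apply: emeasurable_funM => //; exact/measurable_EFinP.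
  - by move=> x _; rewrite mule_ge0// lee_fin indicE.
rewrite preimage_nnfun0// !integral0_eq ?mule0// => x _.
  by rewrite indic0 ?mulr0 mul0e.
by rewrite indic0 ?mulr0 mul0e.
Qed.

(** Indicators, then simple functions, then monotone limits. *)
Lemma ge0_integral_normal_prob (f : measurableTypeR R -> \bar R) :
  measurable_fun setT f -> (forall x, 0 <= f x)%E ->
  (\int[normal_prob m s]_x f x = \int[mu]_x (f x * (normal_pdf m s x)%:E))%E.
Proof.
move=> mf f0; pose f_ := nnsfun_approx measurableT mf.
transitivity (lim (\int[normal_prob m s]_x (f_ n x)%:E @[n --> \oo])%E).
  rewrite -monotone_convergence//=.
  - apply: eq_integral => ? /[!inE] xD; apply/esym/cvg_lim => //=.
    exact: cvg_nnsfun_approx.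
  - by move=> n; exact/measurable_EFinP/measurable_funTS.
  - by move=> n ? _; rewrite lee_fin.
  - by move=> ? _ ? ? mn; rewrite lee_fin; exact/lefP/nd_nnsfun_approx.
under eq_fun do rewrite integral_normal_nnsfun.
rewrite -monotone_convergence//=.
- apply: eq_integral => x /[!inE] xD; apply/cvg_lim => //.
  apply: cvgeZr => //; exact: cvg_nnsfun_approx.
- by move=> n; apply: emeasurable_funM => //; exact/measurable_EFinP.
- by move=> n x _; rewrite mule_ge0// lee_fin.
- move=> x _ a b ab; rewrite lee_wpmul2r//.
  by rewrite lee_fin; exact/lefP/nd_nnsfun_approx.
Qed.

End density.


(** The image of Lebesgue measure by [x |-> a + b * x], scaled by [b], has the same
value as Lebesgue measure on intervals. *)
Lemma ge0_integral_affine (a b : R) (g : measurableTypeR R -> \bar R) :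
  0 < b -> measurable_fun setT g -> (forall x, 0 <= g x)%E ->
  (\int[mu]_x g x = b%:E * \int[mu]_x g (a + b * x)%R)%E.
Proof.
move=> b0 mg g0.
pose f (x : measurableTypeR R) : measurableTypeR R := a + b * x.
have mf : measurable_fun setT f.
  have : measurable_fun setT (f : measurableTypeR R -> R).
    by apply: measurable_funD => //; exact: measurable_funM.
  by move=> H _ A mA; exact: H.
pose F : {mfun measurableTypeR R >-> measurableTypeR R} := mfun_Sub (mem_set mf).
pose c : {nonneg R} := NngNum (ltW b0).
have muE A : measurable A -> mu A = mscale c (pushforward mu F) A.
  apply: lebesgue_measure_unique => _ [[x y] _ <-].
  have fE : f @^-1` [set` `]x, y]%R] = [set` `](x - a) / b, (y - a) / b]%R].
    apply/seteqP; split=> z /=; rewrite !in_itv/= ltr_pdivrMr// ler_pdivlMr// /f;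
    by rewrite ltrBlDr lerBrDr (addrC a) (mulrC b).
  transitivity (b%:E * mu (f @^-1` [set` `]x, y]%R]))%E => //.
  rewrite fE !lebesgue_measure_itv/= !lte_fin ltr_pM2r ?invr_gt0// ltrD2r.
  case: ifP => _; last by rewrite mule0.
  rewrite -!EFinD -EFinM; congr EFin; field.
  by rewrite gt_eqF.
rewrite (eq_measure_integral (mscale c (pushforward mu F))); last first.
  by move=> A mA _; exact: muE.
by rewrite ge0_integral_mscale//= ge0_integral_pushforward.
Qed.

Lemma normal_peakE (s : R) : 0 < s -> normal_peak s = s^-1 * normal_peak 1.
Proof.
move=> s0; rewrite /normal_peak expr1n mul1r -mulrnAr sqrtrM ?sqr_ge0//.
by rewrite sqrtr_sqr ger0_norm ?ltW// invfM.
Qed.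

Lemma ge0_integral_normal_affine (m s : R) (g : measurableTypeR R -> \bar R) :
  0 < s -> measurable_fun setT g -> (forall x, 0 <= g x)%E ->
  (\int[N01]_x g (m + s * x)%R = \int[normal_prob m s]_x g x)%E.
Proof.
move=> s0 mg g0.
have maff : measurable_fun setT
    (fun x : measurableTypeR R => m + s * x : measurableTypeR R).
  have : measurable_fun setT (fun x : measurableTypeR R => m + s * x : R).
    by apply: measurable_funD => //; exact: measurable_funM.
  by move=> H _ A mA; exact: H.
have mpdf m' s' : measurable_fun setT
    (fun x : measurableTypeR R => (normal_pdf m' s' x)%:E).
  by apply/measurable_EFinP; exact: measurable_normal_pdf.
have mga : measurable_fun setT (fun x : measurableTypeR R => g (m + s * x)).
  exact: (measurableT_comp mg maff).
rewrite (ge0_integral_normal_prob 0 1 mga (fun x => g0 _)).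
rewrite (ge0_integral_normal_prob m s mg g0).
rewrite [RHS](ge0_integral_affine m s0); first last.
- by move=> x; rewrite mule_ge0// lee_fin normal_pdf_ge0.
- exact: emeasurable_funM.
rewrite -ge0_integralZl//; first last.
- by rewrite lee_fin ltW.
- by move=> x _; rewrite mule_ge0// lee_fin normal_pdf_ge0.
- apply: emeasurable_funM => //; exact: (measurableT_comp (mpdf _ _) maff).
apply: eq_integral => x _; rewrite muleCA -EFinM; congr (_ * _%:E)%E.
rewrite !normal_pdfE ?oner_eq0 ?gt_eqF// mulrA; congr (_ * _).
  by rewrite (normal_peakE s0) mulrA divff ?mul1r// gt_eqF.
rewrite /normal_fun; congr expR; rewrite expr1n; field.
by rewrite gt_eqF.
Qed.


(** Completing the square in [k (u + x)^2 + x^2 / 2] leaves a multiple of another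
normal density, of variance [1 / (1 + 2 k)]. The negative values of [k] serve the
upper tails of the autoregression, the positive ones its small-ball
probabilities. *)
Lemma integral_expR_sqr_normal (k u : R) : - (1 / 2) < k ->
  (\int[N01]_x (expR (- (k * (u + x) ^+ 2)))%:E =
   ((Num.sqrt (1 + 2 * k))^-1 * expR (- (k / (1 + 2 * k) * u ^+ 2)))%:E)%E.
Proof.
move=> kgt; have k0 : 0 < 1 + 2 * k by lra.
pose s := (Num.sqrt (1 + 2 * k))^-1.
have s0 : 0 < s by rewrite invr_gt0 sqrtr_gt0.
have s2 : s ^+ 2 = (1 + 2 * k)^-1 by rewrite exprVn sqr_sqrtr// ltW.
have mexp : measurable_fun setT
    (fun x : measurableTypeR R => (expR (- (k * (u + x) ^+ 2)))%:E).
  apply/measurable_EFinP; apply: measurableT_comp => //.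
  apply: measurableT_comp => //; apply: measurable_funM => //.
  by apply: measurable_funX; apply: measurable_funD.
rewrite ge0_integral_normal_prob//.
pose C := s * expR (- (k / (1 + 2 * k) * u ^+ 2)).
pose m := - (2 * k * u / (1 + 2 * k)).
transitivity (\int[mu]_x (C%:E * (normal_pdf m s x)%:E))%E; last first.
  rewrite ge0_integralZl//.
  - by rewrite integral_normal_pdf mule1.
  - by apply/measurable_EFinP; exact: measurable_normal_pdf.
  - by move=> x _; rewrite lee_fin normal_pdf_ge0.
  - by rewrite lee_fin mulr_ge0 ?expR_ge0// ltW.
apply: eq_integral => x _; rewrite -!EFinM; congr EFin.
rewrite !normal_pdfE ?oner_eq0 ?gt_eqF// (normal_peakE s0) /C.
rewrite mulrCA [RHS](_ : _ = normal_peak 1 *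
  (expR (- (k / (1 + 2 * k) * u ^+ 2)) * normal_fun m s x)); last first.
  by field; rewrite gt_eqF.
congr (_ * _); rewrite /normal_fun -!expRD; congr expR.
by rewrite s2 /m; field; rewrite gt_eqF.
Qed.

Lemma normal_pdf_center (m s x : R) : 0 < s ->
  normal_pdf m s x = normal_pdf 0 s (x - m).
Proof.
by move=> s0; rewrite !normal_pdfE ?gt_eqF// /normal_fun subr0.
Qed.

(** Bayes' rule for a normal prior and a normal observation: the joint density is
the marginal density of [v] times the posterior density of [x]. *)
Lemma normal_pdf_conv (m a s v x : R) : 0 < s ->
  let t := Num.sqrt (a ^+ 2 + s ^+ 2) in
  normal_pdf (m + a * x) s v * normal_pdf 0 1 x =
  normal_pdf m t v * normal_pdf (a * (v - m) / t ^+ 2) (s / t) x.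
Proof.
move=> s0 t; have t20 : 0 < a ^+ 2 + s ^+ 2.
  by rewrite ltr_wpDl ?sqr_ge0// exprn_gt0.
have t0 : 0 < t by rewrite sqrtr_gt0.
have t2 : t ^+ 2 = a ^+ 2 + s ^+ 2 by rewrite sqr_sqrtr// ltW.
have st0 : 0 < s / t by rewrite divr_gt0.
rewrite !normal_pdfE ?oner_eq0 ?gt_eqF//.
rewrite (normal_peakE s0) (normal_peakE t0) (normal_peakE st0).
rewrite mulrACA [RHS]mulrACA; congr (_ * _).
  by field; rewrite !gt_eqF.
rewrite /normal_fun -!expRD; congr expR.
rewrite expr1n [(s / t) ^+ 2]exprMn exprVn t2.
by field; rewrite !gt_eqF.
Qed.

(** The sum of two independent centred normal variables is normal and the variances
add: integrate [normal_pdf_conv] over [x], where the posterior has mass 1. *)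
Lemma ge0_integral_normal_conv (m a s : R) (g : measurableTypeR R -> \bar R) :
  0 < s -> measurable_fun setT g -> (forall x, 0 <= g x)%E ->
  (\int[N01]_x \int[N01]_z g (m + a * x + s * z)%R =
   \int[N01]_z g (m + Num.sqrt (a ^+ 2 + s ^+ 2) * z)%R)%E.
Proof.
move=> s0 mg g0; set t := Num.sqrt _.
have t0 : 0 < t by rewrite sqrtr_gt0 ltr_wpDl ?sqr_ge0// exprn_gt0.
have mpdf m' s' : measurable_fun setT
    (fun x : measurableTypeR R => (normal_pdf m' s' x)%:E).
  by apply/measurable_EFinP; exact: measurable_normal_pdf.
have pdf0 m' s' x : (0 <= (normal_pdf m' s' x : R)%:E)%E.
  by rewrite lee_fin normal_pdf_ge0.
have m1 : measurable_fun setT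
    (fun z : measurableTypeR R * measurableTypeR R => z.1 : R).
  by move=> _ A mA; exact: (measurable_fst measurableT).
have m2 : measurable_fun setT
    (fun z : measurableTypeR R * measurableTypeR R => z.2 : R).
  by move=> _ A mA; exact: (measurable_snd measurableT).
pose h' (z : measurableTypeR R * measurableTypeR R) :=
  (g z.2 * (normal_pdf (m + a * z.1) s z.2)%:E)%E.
pose h z := (h' z * (normal_pdf 0 1 z.1)%:E)%E.
have mh' : measurable_fun setT h'.
  apply: emeasurable_funM; first exact: (measurableT_comp mg).
  apply/measurable_EFinP.
  under eq_fun do rewrite normal_pdf_center//.
  apply: (measurableT_comp (measurable_normal_pdf 0 s)).
  apply: measurable_funB => //; apply: measurable_funD => //.
  exact: measurable_funM.
have mh : measurable_fun setT h.
  apply: emeasurable_funM => //.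
  exact: (measurableT_comp (mpdf 0 1)).
have h'0 z : (0 <= h' z)%E by rewrite mule_ge0.
have h0 z : (0 <= h z)%E by rewrite mule_ge0.
under eq_integral => x _.
  rewrite ge0_integral_normal_affine// ge0_integral_normal_prob//.
  rewrite [X in integral _ _ X](_ : _ = fun v => h' (x, v))//.
  over.
rewrite /= ge0_integral_normal_prob//; first last.
- by move=> x; exact: integral_ge0.
- exact: measurable_fun_fubini_tonelli_F.
transitivity (\int[mu]_x \int[mu]_v h (x, v))%E.
  apply: eq_integral => x _; rewrite -ge0_integralZr//.
  exact: (measurableT_comp mh').
rewrite fubini_tonelli// ge0_integral_normal_affine// ge0_integral_normal_prob//.
apply: eq_integral => v _.
under eq_integral do rewrite /h /h' /= -muleA -EFinM normal_pdf_conv// EFinM muleA.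
rewrite ge0_integralZl//.
- by rewrite integral_normal_pdf mule1.
- by rewrite mule_ge0.
Qed.

End gaussian.

Section moments.
Context (R : realType).
Local Notation mu := (@lebesgue_measure R).
Local Notation N01 := (normal_prob (0 : R) (1 : R)).

Lemma ge0_integral_normalN (g : measurableTypeR R -> \bar R) :
  measurable_fun setT g -> (forall x, 0 <= g x)%E ->
  (\int[N01]_x g (- x)%R = \int[N01]_x g x)%E.
Proof.
move=> mg g0.
have mN : measurable_fun setT
    (-%R : measurableTypeR R -> measurableTypeR R) by [].
have mpdf : measurable_fun setT
    (fun x : measurableTypeR R => (normal_pdf 0 1 x)%:E).
  by apply/measurable_EFinP; exact: measurable_normal_pdf.
have mgN : measurable_fun setT (fun x : measurableTypeR R => g (- x)).
  exact: (measurableT_comp mg mN).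
pose h (x : measurableTypeR R) := (g x * (normal_pdf 0 1 x)%:E)%E.
have mh : measurable_fun setT h by exact: emeasurable_funM.
have h0 x : (0 <= h x)%E by rewrite mule_ge0// lee_fin normal_pdf_ge0.
rewrite (ge0_integral_normal_prob 0 1 mgN (fun x => g0 _)).
rewrite (ge0_integral_normal_prob 0 1 mg g0) -/h.
rewrite [RHS](eq_measure_integral
  (pushforward mu (-%R : measurableTypeR R -> measurableTypeR R))); last first.
  by move=> A mA _; exact/esym/lebesgue_measureN.
rewrite (ge0_integral_pushforward mN _ measurableT mh (fun x _ => h0 x)).
rewrite /h.
apply: eq_integral => x _ /=; congr (_ * _%:E)%E.
by rewrite !normal_pdfE ?oner_eq0// /normal_fun !subr0 sqrrN.
Qed.

(** The exact value is 1; the cruder constant comes from [x^2 <= 4 exp (x^2 / 4)]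
and [integral_expR_sqr_normal], and only finiteness matters below. *)
Lemma normal_second_moment : (\int[N01]_x ((x ^+ 2)%:E) <= 6%:E)%E.
Proof.
apply: (@le_trans _ _ (\int[N01]_x (4%:E *
    (expR (- (- (1 / 4) * (0 + x) ^+ 2)))%:E)))%E.
  apply: ge0_le_integral => //.
  - by move=> x _; rewrite lee_fin sqr_ge0.
  - by apply/measurable_EFinP; exact: measurable_funX.
  - apply/measurable_EFinP; apply: measurable_funM => //.
    apply: measurableT_comp => //; apply: measurableT_comp => //.
    by apply: measurable_funM => //; apply: measurable_funX; apply: measurable_funD.
  - move=> x _; rewrite -EFinM lee_fin add0r.
    by have := expR_ge1Dx (- (- (1 / 4) * x ^+ 2)); lra.
rewrite ge0_integralZl//; last first.
  apply/measurable_EFinP.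
  apply: measurableT_comp => //; apply: measurableT_comp => //.
  by apply: measurable_funM => //; apply: measurable_funX; apply: measurable_funD.
rewrite integral_expR_sqr_normal; last by lra.
rewrite expr0n/= mulr0 oppr0 expR0 mulr1 -EFinM lee_fin.
rewrite ler_pdivrMr; last by rewrite sqrtr_gt0; lra.
have : 2 / 3 <= Num.sqrt (1 + 2 * - (1 / 4)) :> R.
  rewrite -[leLHS]ger0_norm; last by lra.
  by rewrite -sqrtr_sqr ler_wsqrtr//; lra.
lra.
Qed.

(** Averaging over [x] and [- x] removes the cross term. *)
Lemma normal_second_moment_affine (u b : R) :
  (\int[N01]_x (((u + b * x) ^+ 2)%:E) <= (u ^+ 2 + 6 * b ^+ 2)%:E)%E.
Proof.
have mq c : measurable_fun setT
    (fun x : measurableTypeR R => ((u + c * x) ^+ 2)%:E).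
  apply/measurable_EFinP; apply: measurable_funX; apply: measurable_funD => //.
set I := (\int[_]_x _)%E.
have I0 : (0 <= I)%E by apply: integral_ge0 => x _; rewrite lee_fin sqr_ge0.
have IN : (I = \int[N01]_x (((u + - b * x) ^+ 2)%:E))%E.
  rewrite /I -[LHS]ge0_integral_normalN//; last first.
    by move=> x; rewrite lee_fin sqr_ge0.
  by apply: eq_integral => x _; rewrite mulrN mulNr.
have mx2 : measurable_fun setT (fun x : measurableTypeR R => (x ^+ 2)%:E).
  by apply/measurable_EFinP; exact: measurable_funX.
suff : (I + I <= (u ^+ 2 + 6 * b ^+ 2 + (u ^+ 2 + 6 * b ^+ 2))%:E)%E.
  have half (J : \bar R) (r : R) : (J + J <= (r + r)%:E -> J <= r%:E)%E.
    by case: J => [j| |]//=; rewrite ?leey ?leNye// !lee_fin => ?; lra.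
  exact: half.
rewrite {2}IN /I -ge0_integralD//; try by move=> x _; rewrite lee_fin sqr_ge0.
rewrite (eq_integral (fun x : measurableTypeR R =>
  (2 * u ^+ 2)%:E + (2 * b ^+ 2)%:E * (x ^+ 2)%:E))%E; last first.
  by move=> x _; rewrite -!EFinM -!EFinD; congr EFin; ring.
have b20 : 0 <= 2 * b ^+ 2 by rewrite mulr_ge0 ?sqr_ge0.
have u20 : 0 <= 2 * u ^+ 2 by rewrite mulr_ge0 ?sqr_ge0.
rewrite ge0_integralD//; last 2 first.
- by move=> x _; rewrite mule_ge0 ?lee_fin ?sqr_ge0.
- exact: emeasurable_funM.
rewrite integral_cst//.
rewrite [X in (_ * X)%E]probability_setT mule1 ge0_integralZl//; last first.
  by move=> x _; rewrite lee_fin sqr_ge0.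
apply: (@le_trans _ _ ((2 * u ^+ 2)%:E + (2 * b ^+ 2)%:E * 6%:E)%E).
  by rewrite leeD2l// lee_wpmul2l// normal_second_moment.
by rewrite -EFinM -EFinD lee_fin; lra.
Qed.

End moments.

(** * Predictable Gaussian sums *)

Lemma measurable_sum_nat d (T : measurableType d) (R : realType)
    (h : nat -> T -> R) n :
  (forall i, (1 <= i <= n)%N -> measurable_fun setT (h i)) ->
  measurable_fun setT (fun t => \sum_(1 <= i < n.+1) h i t).
Proof.
elim: n => [|n IH] mh.
  by under eq_fun do rewrite big_geq//; exact: measurable_cst.
under eq_fun do rewrite big_nat_recr//=.
apply: measurable_funD; last by apply: mh; rewrite leqnn.
by apply: IH => i /andP[i1 ile]; apply: mh; rewrite i1 (leq_trans ile).
Qed.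

Lemma measurable_sqrt (R : realType) : measurable_fun setT (@Num.sqrt R).
Proof. by apply: continuous_measurable_fun; exact: sqrt_continuous. Qed.

Section gaussian_sums.
Context d (T : measurableType d) (R : realType) (P : probability T R).
Variable eps : nat -> {RV P >-> R}.
Local Notation N01 := (normal_prob (0 : R) (1 : R)).
Local Notation R' := (measurableTypeR R).
Hypothesis eps_indep : mutually_independent [set i : nat | (1 <= i)%N] eps.
Hypothesis eps_law : forall i, (1 <= i)%N -> has_law (eps i) N01.

Let gfub n d' (V : measurableType d') (U : T -> V) (h : V * R' -> \bar R) :=
  @adapted_fubini _ _ _ _ _ _ eps_indep eps_law n d' V U h.

(** Given the past, [a * eps n.+1] and an independent normal variable of standard
deviation [s] merge into one normal variable, of variance [a^2 + s^2]. *)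
Lemma adapted_gaussian_step n (m a s : T -> R) (g : R' -> \bar R) :
  adapted eps n m -> adapted eps n a -> adapted eps n s ->
  (forall t, 0 < s t) -> measurable_fun setT g -> (forall x, 0 <= g x)%E ->
  (\int[P]_t \int[N01]_z g (m t + a t * eps n.+1 t + s t * z)%R =
   \int[P]_t \int[N01]_z g (m t + Num.sqrt (a t ^+ 2 + s t ^+ 2) * z)%R)%E.
Proof.
move=> am aa sa s0 mg g0.
pose V := (R * R * R)%type.
pose U t : V := (m t, a t, s t).
have mU : adapted eps n U by do 2 apply: measurable_fun_pair => //.
pose f (q : V * R' * R') : \bar R :=
  g (q.1.1.1.1 + q.1.1.1.2 * (q.1.2 : R) + q.1.1.2 * (q.2 : R)).
have mf : measurable_fun setT f.
  have m2 : measurable_fun setT (fun q : V * R' * R' => q.2 : R).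
    by move=> _ A mA; exact: (measurable_snd measurableT).
  have m1 : measurable_fun setT (fun q : V * R' => q.2 : R).
    by move=> _ A mA; exact: (measurable_snd measurableT).
  have : measurable_fun setT (fun q : V * R' * R' =>
     q.1.1.1.1 + q.1.1.1.2 * (q.1.2 : R) + q.1.1.2 * (q.2 : R)).
    have m12 : measurable_fun setT (fun q : V * R' * R' => q.1.2 : R).
      exact: (measurableT_comp m1).
    have m11 : measurable_fun setT (fun q : V * R' * R' => q.1.1).
      exact: (measurableT_comp measurable_fst).
    have m111 : measurable_fun setT (fun q : V * R' * R' => q.1.1.1).
      exact: (measurableT_comp measurable_fst).
    apply: measurable_funD; last first.
      by apply: measurable_funM => //; exact: (measurableT_comp measurable_snd).
    apply: measurable_funD; first exact: (measurableT_comp measurable_fst).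
    by apply: measurable_funM => //; exact: (measurableT_comp measurable_snd).
  move=> mp; apply: (measurableT_comp mg) => _ A mA; exact: mp.
have f0 q : (0 <= f q)%E by exact: g0.
pose h (q : V * R') := (\int[N01]_z f (q, z))%E.
have mh : measurable_fun setT h by exact: measurable_fun_fubini_tonelli_F.
have h0 q : (0 <= h q)%E by exact: integral_ge0.
transitivity (\int[P]_t h (U t, eps n.+1 t))%E; first reflexivity.
rewrite (gfub mU mh h0).
by apply: eq_integral => t _; exact: ge0_integral_normal_conv.
Qed.

Section predictable.
Variables (n : nat) (a : nat -> T -> R).
Hypothesis a_pred : forall i, (1 <= i <= n)%N -> adapted eps i.-1 (a i).
Hypothesis a_lt1 : forall t, \sum_(1 <= i < n.+1) a i t ^+ 2 < 1.

Let M k t := \sum_(1 <= i < k.+1) a i t * eps i t.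
Let V k t := 1 - \sum_(1 <= i < k.+1) a i t ^+ 2.

Let V_gt0 k t : (k <= n)%N -> 0 < V k t.
Proof.
move=> kn; rewrite subr_gt0; apply: le_lt_trans (a_lt1 t).
rewrite [leRHS](big_cat_nat _ (n := k.+1))//= lerDl.
by apply: sumr_ge0 => i _; exact: sqr_ge0.
Qed.

Let adapted_a k i : (1 <= i <= n)%N -> (i <= k.+1)%N -> adapted eps k (a i).
Proof.
move=> i1n ik; apply: adapted_le (a_pred i1n).
by case: i i1n ik => [//|i] _.
Qed.

Let adapted_M k : (k <= n)%N -> adapted eps k (M k).
Proof.
move=> kn; apply: measurable_sum_nat => i /andP[i1 ik].
have i1n : (1 <= i <= n)%N by rewrite i1 (leq_trans ik).
apply: measurable_funM; first by apply: adapted_a => //; exact: leqW.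
by apply: adapted_eps; rewrite i1.
Qed.

Let adapted_V k j : (j <= n)%N -> (j <= k.+1)%N ->
  adapted eps k (fun t => Num.sqrt (V j t)).
Proof.
move=> jn jk; apply: (measurableT_comp (@measurable_sqrt R)).
apply: measurable_funB => //; apply: measurable_sum_nat => i /andP[i1 ij].
apply: measurable_funX; apply: adapted_a; last exact: leq_trans jk.
by rewrite i1 (leq_trans ij).
Qed.

(** Let [M k] be the partial sum and [V k] the variance that is still missing after
[k] terms. The law of [M k + sqrt (V k) * Z], for an independent standard normal
[Z], does not depend on [k] by [adapted_gaussian_step]. It is N(0,1) at [k = 0],
and at [k = n] the variable [eps n.+1] can play the role of [Z]. *)
Lemma predictable_gaussian_sum (A : set R) : measurable A ->
  P [set t | A (\sum_(1 <= i < n.+1) a i t * eps i t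
    + Num.sqrt (1 - \sum_(1 <= i < n.+1) a i t ^+ 2) * eps n.+1 t)] = N01 A.
Proof.
move=> mA.
pose g (x : R') : \bar R := (\1_A x)%:E.
have mg : measurable_fun setT g by apply/measurable_EFinP.
have g0 x : (0 <= g x)%E by rewrite lee_fin.
pose I k := (\int[P]_t \int[N01]_z g (M k t + Num.sqrt (V k t) * z)%R)%E.
have I0 : I 0%N = N01 A.
  rewrite /I /M /V.
  under eq_integral do under eq_integral do rewrite !big_geq// subr0 sqrtr1 mul1r add0r.
  have -> : (\int[N01]_x g x = N01 A)%E by rewrite integral_indic//= setIT.
  by rewrite integral_cst//= probability_setT mule1.
have IS k : (k < n)%N -> I k.+1 = I k.
  move=> kn; pose s t := Num.sqrt (V k.+1 t).
  have am : adapted eps k (M k) by apply: adapted_M; exact: ltnW.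
  have aa : adapted eps k (a k.+1) by exact: adapted_a.
  have as_ : adapted eps k s by exact: adapted_V.
  have s0 t : 0 < s t by rewrite sqrtr_gt0 V_gt0.
  have E1 : I k.+1 = (\int[P]_t \int[N01]_z
      g (M k t + a k.+1 t * eps k.+1 t + s t * z)%R)%E.
    (apply: eq_integral => t _; apply: eq_integral => z _).
    (by congr (g (_ + _)); rewrite /M big_nat_recr).
  have E2 t : Num.sqrt (a k.+1 t ^+ 2 + s t ^+ 2) = Num.sqrt (V k t).
    have VS : V k t = V k.+1 t + a k.+1 t ^+ 2.
      rewrite /V [in RHS](big_nat_recr k.+1)//.
      by rewrite opprD addrA subrK.
    by rewrite /s (sqr_sqrtr (ltW (V_gt0 t kn))) VS addrC.
  rewrite E1 (adapted_gaussian_step am aa as_ s0 mg g0).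
  by apply: eq_integral => t _; rewrite E2.
have In k : (k <= n)%N -> I k = N01 A.
  elim: k => [_|k IH kn]; first exact: I0.
  by rewrite (IS k kn) (IH (ltnW kn)).
rewrite -(In n (leqnn n)).
pose h (q : (R * R) * R') := g (q.1.1 + q.1.2 * (q.2 : R)).
have mh : measurable_fun setT h.
  have m2 : measurable_fun setT (fun q : (R * R) * R' => q.2 : R).
    by move=> _ B mB; exact: (measurable_snd measurableT).
  have mp : measurable_fun setT
      (fun q : (R * R) * R' => q.1.1 + q.1.2 * (q.2 : R)).
    apply: measurable_funD; first exact: (measurableT_comp measurable_fst).
    by apply: measurable_funM => //; exact: (measurableT_comp measurable_snd).
  by apply: (measurableT_comp mg) => _ B mB; exact: mp.
have aU : adapted eps n (fun t => (M n t, Num.sqrt (V n t))).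
  by apply: measurable_fun_pair; [exact: adapted_M|exact: adapted_V].
have h0 q : (0 <= h q)%E by exact: g0.
transitivity (\int[P]_t h ((M n t, Num.sqrt (V n t)), eps n.+1 t))%E; last first.
  by rewrite (gfub aU mh h0).
pose F t := M n t + Num.sqrt (V n t) * eps n.+1 t.
have mF : measurable_fun setT F.
  apply: measurable_funD.
    exact: (adapted_measurable (adapted_M (leqnn n))).
  apply: measurable_funM => //.
  exact: (adapted_measurable (adapted_V (leqnn n) (leqnSn n))).
have mFA : measurable (F @^-1` A).
  by rewrite -[X in measurable X]setTI; exact: mF.
transitivity (P (F @^-1` A)); first by [].
rewrite -[X in P X = _]setIT -(integral_indic P measurableT mFA).
by apply: eq_integral.
Qed.

End predictable.
End gaussian_sums.

(** * The debiasing weights along one trajectory *)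

Section od_weights.
Context (R : realType).
Variables (gamma : R) (z : nat -> R).
Hypothesis gamma0 : 0 < gamma.

Let r i := 1 - od_wz gamma z i.
Let w := od_w gamma z.

Let den_gt0 i : 0 < gamma / 2 + z i ^+ 2.
Proof. by rewrite ltr_pwDl ?sqr_ge0// divr_gt0. Qed.

Let rS k : r k.+1 = r k * (gamma / 2) / (gamma / 2 + z k.+1 ^+ 2).
Proof. rewrite /r /=; have := den_gt0 k.+1; move=> h; field; rewrite gt_eqF//; lra. Qed.

Lemma od_residual_gt0 k : 0 < 1 - od_wz gamma z k.
Proof.
rewrite -/(r k); elim: k => [|k IH]; first by rewrite /r/= subr0.
by rewrite rS; rewrite divr_gt0// mulr_gt0// divr_gt0.
Qed.

Lemma od_w_z_ge0 k : 0 <= od_w gamma z k.+1 * z k.+1.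
Proof.
rewrite /od_w /=; set u := 1 - _; set x := z k.+1; set D := _ + x ^+ 2.
have -> : u * x / D * x = u * (x ^+ 2 / D) by ring.
apply: mulr_ge0; first exact: ltW (od_residual_gt0 k).
by rewrite divr_ge0 ?sqr_ge0// ltW// den_gt0.
Qed.

Lemma sum_od_w_z n :
  \sum_(1 <= i < n.+1) od_w gamma z i * z i = od_wz gamma z n.
Proof.
elim: n => [|n IH]; first by rewrite big_geq.
by rewrite big_nat_recr//= IH.
Qed.

(** The residual is multiplied by [(gamma / 2) / (gamma / 2 + z^2)] at each step, so
each term on the left is the decrease of the squared residual. The choice of
[gamma / 2] in the recursion of the weights is what makes this telescope. *)
Lemma sum_od_w_sqr n :
  \sum_(1 <= i < n.+1) od_w gamma z i ^+ 2 * (gamma + z i ^+ 2) =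
  1 - (1 - od_wz gamma z n) ^+ 2.
Proof.
elim: n => [|n IH]; first by rewrite big_geq// /= subr0 expr1n subrr.
rewrite big_nat_recr//= IH /od_w /= -/(r n).
have -> : od_wz gamma z n = 1 - r n by rewrite /r; ring.
have := den_gt0 n.+1; move: (z n.+1) (r n) => x y h.
by field; rewrite gt_eqF//; lra.
Qed.

Lemma sum_od_w_sqr_lt1 n :
  \sum_(1 <= i < n.+1) (Num.sqrt gamma * od_w gamma z i) ^+ 2 < 1.
Proof.
apply: (@le_lt_trans _ _ (1 - (1 - od_wz gamma z n) ^+ 2)).
  rewrite -sum_od_w_sqr; apply: ler_sum => i _.
  rewrite exprMn sqr_sqrtr ?(ltW gamma0)// mulrC.
  by rewrite ler_wpM2l ?sqr_ge0// lerDl sqr_ge0.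
by rewrite ltrBlDr ltrDl exprn_gt0// od_residual_gt0.
Qed.

(** A small [z i ^+ 2] makes [gamma] and [gamma + z i ^+ 2] comparable, so that
[sum_od_w_sqr] also bounds the weights from below. *)
Lemma od_residual_variance n (zeta : R) :
  (forall i, (1 <= i <= n)%N -> z i ^+ 2 <= zeta) -> 0 <= zeta ->
  1 - \sum_(1 <= i < n.+1) (Num.sqrt gamma * od_w gamma z i) ^+ 2 <=
  (1 - od_wz gamma z n) ^+ 2 + zeta / gamma.
Proof.
move=> hz zeta0.
set s := \sum_(1 <= i < n.+1) _.
have s0 : 0 <= s by apply: sumr_ge0 => i _; exact: sqr_ge0.
have : 1 - (1 - od_wz gamma z n) ^+ 2 <= s * (1 + zeta / gamma).
  rewrite -sum_od_w_sqr mulr_suml; apply: ler_sum_nat => i i1n.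
  have -> : (Num.sqrt gamma * od_w gamma z i) ^+ 2 =
      gamma * od_w gamma z i ^+ 2 by rewrite exprMn sqr_sqrtr// ltW.
  have -> : gamma * od_w gamma z i ^+ 2 * (1 + zeta / gamma) =
      od_w gamma z i ^+ 2 * (gamma + zeta) by field; rewrite gt_eqF.
  by rewrite ler_wpM2l ?sqr_ge0// lerD2l; apply: hz; lia.
have : s * (zeta / gamma) <= zeta / gamma.
  apply: ler_piMl; first by rewrite divr_ge0// ltW.
  exact/ltW/sum_od_w_sqr_lt1.
lra.
Qed.

(** The inverse residual is the product of the [1 + 2 z i ^+ 2 / gamma], which is at
least the corresponding sum. *)
Lemma od_residual_inv n :
  1 + 2 / gamma * \sum_(1 <= i < n.+1) z i ^+ 2 <= (1 - od_wz gamma z n)^-1.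
Proof.
rewrite -/(r n); elim: n => [|n IH].
  by rewrite big_geq// mulr0 addr0 /r /= subr0 invr1.
rewrite big_nat_recr//= rS.
have r0 : 0 < r n by exact: od_residual_gt0.
have -> : (r n * (gamma / 2) / (gamma / 2 + z n.+1 ^+ 2))^-1 =
    (r n)^-1 + (r n)^-1 * (2 / gamma * z n.+1 ^+ 2).
  have h := den_gt0 n.+1; field; rewrite !gt_eqF//=; lra.
rewrite mulrDr addrA lerD// ler_peMl//.
  by rewrite mulr_ge0 ?sqr_ge0// divr_ge0// ltW.
apply: le_trans IH; rewrite lerDl mulr_ge0//; first by rewrite divr_ge0// ltW.
by apply: sumr_ge0 => i _; exact: sqr_ge0.
Qed.

End od_weights.

Section od_trajectory.
Context (R : realType).
Variables (theta : R) (y e : nat -> R) (n : nat).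
Hypothesis y0 : y 0%N = 0.
Hypothesis yE : forall i, (1 <= i)%N -> y i = theta * y i.-1 + e i.

Local Notation gamma := (od_gamma R n).
Local Notation Gamma := (od_Gamma y n).
Local Notation z := (od_z Gamma y).
Local Notation w := (od_w gamma z).
Local Notation S := (gram y n).

Lemma gram_ge0 m : 0 <= gram y m.
Proof. by apply: sumr_ge0 => i _; exact: sqr_ge0. Qed.

Lemma gramS m : gram y m.+1 = gram y m + y m ^+ 2.
Proof. by rewrite /gram big_nat_recr. Qed.

Lemma gram_le m1 m2 : (m1 <= m2)%N -> gram y m1 <= gram y m2.
Proof.
elim: m2 => [|m IH]; first by rewrite leqn0 => /eqP ->.
rewrite leq_eqVlt => /orP[/eqP -> //|/IH h].
by rewrite gramS (le_trans h)// lerDl sqr_ge0.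
Qed.

(** This is where [y 0 = 0] enters: the normalization [od_Gamma] sums the squares of
the past values from index 1 on, the Gram sum does so from index 0 on. *)
Lemma gram_past i : (1 <= i)%N -> \sum_(1 <= j < i) y j ^+ 2 = gram y i.
Proof.
case: i => // i _; elim: i => [|i IH].
  by rewrite big_geq// /gram big_nat1 y0 expr0n.
by rewrite big_nat_recr//= IH [RHS]gramS.
Qed.

Hypothesis S_gt0 : 0 < S.
Hypothesis ln_gt0 : 0 < ln n%:R :> R.
Hypothesis gamma_gt0 : 0 < gamma.

(** The least squares error is [M / S], and the debiasing step turns it into a
weighted sum of the noise plus what the weights fail to correct. *)
Lemma od_errorE :
  Num.sqrt (S / log_loglog R n) * (theta_OD gamma Gamma y n - theta) =
  \sum_(1 <= i < n.+1) (Num.sqrt gamma * w i) * e i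
  + Num.sqrt gamma * ((\sum_(1 <= i < n.+1) y i.-1 * e i) / Num.sqrt S)
    * (1 - (Num.sqrt S)^-1 * \sum_(1 <= i < n.+1) w i * y i.-1).
Proof.
rewrite sqrtrM ?(ltW S_gt0)// -/(od_gamma R n).
set g := Num.sqrt gamma; set s := Num.sqrt S.
have s0 : 0 < s by rewrite sqrtr_gt0.
have s2 : S = s ^+ 2 by rewrite sqr_sqrtr// (ltW S_gt0).
set M := \sum_(1 <= i < n.+1) y i.-1 * e i.
set W := \sum_(1 <= i < n.+1) w i * y i.-1.
have yi i : (1 <= i < n.+1)%N -> y i = theta * y i.-1 + e i.
  by move=> /andP[i1 _]; exact: yE.
have LS : theta_LS y n = theta + M / s ^+ 2.
  rewrite /theta_LS (eq_big_nat _ _ (F2 := fun i => theta * y i.-1 ^+ 2 + y i.-1 * e i)).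
    rewrite big_split/= -mulr_sumr -/S -/M s2.
    by field; rewrite gt_eqF.
  by move=> i i1n; rewrite (yi i i1n); ring.
rewrite /theta_OD LS -/s.
rewrite (eq_big_nat _ _ (F2 := fun i => w i * e i - M / s ^+ 2 * (w i * y i.-1))); last first.
  by move=> i i1n; rewrite (yi i i1n); ring.
rewrite sumrB -mulr_sumr -/W.
under [in RHS]eq_bigr do rewrite -mulrA.
rewrite -mulr_sumr; set E := \sum_(_ <= _ < _) w _ * e _.
by field; rewrite gt_eqF.
Qed.

Let Gamma_ge i : (ln n%:R) ^+ 2 * y i.-1 ^+ 2 <= Gamma i.
Proof. by rewrite /od_Gamma le_max lexx. Qed.

Let Gamma_ge0 i : 0 <= Gamma i.
Proof. by rewrite (le_trans _ (Gamma_ge i))// mulr_ge0 ?sqr_ge0. Qed.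

Let z_sqr i : z i ^+ 2 = y i.-1 ^+ 2 / Gamma i.
Proof. by rewrite /od_z exprMn exprVn sqr_sqrtr// mulrC. Qed.

Lemma od_z_sqr_le i : z i ^+ 2 <= (ln n%:R ^+ 2)^-1.
Proof.
have l2 : 0 < ln n%:R ^+ 2 :> R by rewrite exprn_gt0.
rewrite z_sqr; have := Gamma_ge0 i; rewrite le_eqVlt => /orP[/eqP <-|G0].
  by rewrite invr0 mulr0 invr_ge0 ltW.
by rewrite ler_pdivrMr// mulrC ler_pdivlMr// mulrC.
Qed.

Hypothesis small : forall i, (1 <= i <= n)%N ->
  ln n%:R ^+ 2 * y i.-1 ^+ 2 <= S / 2.

Let Gamma_le i : (1 <= i <= n)%N -> Gamma i <= S.
Proof.
move=> i1n; have /andP[i1 ilen] := i1n.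
rewrite /od_Gamma ge_max gram_past// gram_le// andbT.
apply: le_trans (small i1n) _; have := S_gt0; move: (gram y n) => s ?; lra.
Qed.

(** As long as [gram y i] is below [S / 2] nothing is claimed. Above that level
[od_Gamma y n i] lies between [gram y i] and [S], so that [z i ^+ 2] is at least
[y i.-1 ^+ 2 / S], and the remaining squares amount to half of [S]. *)
Lemma sum_od_z_sqr_ge : 1 / 2 <= \sum_(1 <= i < n.+1) z i ^+ 2.
Proof.
suff H k : (k <= n)%N ->
    (gram y k - S / 2) / S <= \sum_(1 <= i < k.+1) z i ^+ 2.
  apply: le_trans (H n (leqnn n)).
  by rewrite ler_pdivlMr//; lra.
elim: k => [|k IH] kn.
  rewrite big_geq// /gram big_geq// sub0r mulNr oppr_le0.
  by rewrite !divr_ge0 ?(ltW S_gt0).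
have [kS|Sk] := leP (gram y k.+1) (S / 2).
  apply: (@le_trans _ _ 0); last by apply: sumr_ge0 => i _; exact: sqr_ge0.
  by rewrite pmulr_lle0 ?invr_gt0// subr_le0.
rewrite big_nat_recr//= gramS.
have -> : (gram y k + y k ^+ 2 - S / 2) / S = (gram y k - S / 2) / S + y k ^+ 2 / S.
  by field; rewrite gt_eqF.
rewrite lerD ?IH//; first exact: ltnW.
have k1n : (1 <= k.+1 <= n)%N by [].
rewrite z_sqr ler_wpM2l ?sqr_ge0// lef_pV2 ?posrE//; first exact: Gamma_le.
apply: (@lt_le_trans _ _ (gram y k.+1)).
  by apply: le_lt_trans Sk; rewrite divr_ge0 ?(ltW S_gt0).
by rewrite /od_Gamma gram_past// le_max lexx orbT.
Qed.

Lemma od_residual_le_gamma : 1 - od_wz gamma z n <= gamma.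
Proof.
have := od_residual_inv z gamma_gt0 n.
have r0 := od_residual_gt0 z gamma_gt0 n.
set r := 1 - _ in r0 *; move=> H.
have : gamma^-1 <= r^-1.
  apply: le_trans H; have := sum_od_z_sqr_ge.
  set s := \sum_(_ <= _ < _) _ => hs.
  apply: (@le_trans _ _ (2 / gamma * (1 / 2))).
    by rewrite (_ : 2 / gamma * (1 / 2) = gamma^-1)//; field; rewrite gt_eqF.
  apply: (@le_trans _ _ (2 / gamma * s)); last by rewrite lerDr.
  by rewrite ler_wpM2l// divr_ge0// ltW.
by rewrite lef_pV2// posrE.
Qed.

(** Since [w i * y i.-1 = sqrt (Gamma i) * (w i * z i)] with [Gamma i <= S], and the
nonnegative numbers [w i * z i] add up to at most 1. *)
Lemma od_shrinkage_bound :
  0 <= 1 - (Num.sqrt S)^-1 * \sum_(1 <= i < n.+1) w i * y i.-1 <= 1.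
Proof.
have s0 : 0 < Num.sqrt S by rewrite sqrtr_gt0.
have wy i : (1 <= i < n.+1)%N ->
    0 <= w i * y i.-1 <= Num.sqrt S * (w i * z i).
  case: i => // i /= ilen.
  have wz0 : 0 <= w i.+1 * z i.+1 by exact: od_w_z_ge0.
  have -> : w i.+1 * y i = Num.sqrt (Gamma i.+1) * (w i.+1 * z i.+1).
    rewrite /od_z /=; have := Gamma_ge0 i.+1.
    rewrite le_eqVlt => /orP[/eqP G0|G0].
      have := Gamma_ge i.+1; rewrite -G0 /= pmulr_rle0 ?exprn_gt0// => y2.
      have /eqP : y i ^+ 2 = 0 by apply/eqP; rewrite eq_le y2 sqr_ge0.
      by rewrite sqrf_eq0 => /eqP ->; rewrite !mulr0.
    by field; rewrite gt_eqF// sqrtr_gt0.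
  rewrite mulr_ge0 ?sqrtr_ge0//= ler_wpM2r// ler_wsqrtr//.
  exact: Gamma_le.
have W0 : 0 <= \sum_(1 <= i < n.+1) w i * y i.-1.
  rewrite big_nat_cond; apply: sumr_ge0 => i /andP[i1n _].
  by have /andP[] := wy i i1n.
have WS : \sum_(1 <= i < n.+1) w i * y i.-1 <= Num.sqrt S.
  apply: (@le_trans _ _ (Num.sqrt S * \sum_(1 <= i < n.+1) w i * z i)).
    by rewrite mulr_sumr; apply: ler_sum_nat => i i1n; have /andP[] := wy i i1n.
  rewrite sum_od_w_z ler_piMr ?ltW//.
  by have := od_residual_gt0 z gamma_gt0 n; lra.
apply/andP; split; last by rewrite lerBlDr lerDl mulr_ge0// invr_ge0 ltW.
by rewrite subr_ge0 mulrC ler_pdivrMr// mul1r.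
Qed.

Hypothesis S_ge1 : 1 <= S.

(** The difference is the bias minus the added term, and its square is at most twice
the sum of their squares. Replacing [S] by [1 + S] costs another factor 2, as
[S >= 1]. *)
Lemma od_error_approx (v : R) : gamma ^+ 2 + (ln n%:R ^+ 2)^-1 / gamma <= v ->
  let X := Num.sqrt (S / log_loglog R n) * (theta_OD gamma Gamma y n - theta) in
  let Z := \sum_(1 <= i < n.+1) (Num.sqrt gamma * w i) * e i
    + Num.sqrt (1 - \sum_(1 <= i < n.+1) (Num.sqrt gamma * w i) ^+ 2) * e n.+1 in
  let Q2 : R := (\sum_(1 <= i < n.+1) y i.-1 * e i) ^+ 2 / (1 + S) in
  (X - Z) ^+ 2 <= 4 * (gamma * Q2) + 2 * (v * e n.+1 ^+ 2).
Proof.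
move=> hv; rewrite /= od_errorE.
set Q2 := _ / (1 + S).
set a := \sum_(1 <= i < n.+1) (Num.sqrt gamma * w i) * e i.
set M := \sum_(1 <= i < n.+1) y i.-1 * e i in Q2 *.
set k := 1 - _ * \sum_(1 <= i < n.+1) w i * y i.-1.
set V := 1 - \sum_(1 <= i < n.+1) _ ^+ 2.
set B := _ * _ * k.
have V0 : 0 <= V by rewrite subr_ge0 ltW// sum_od_w_sqr_lt1.
have Vv : V <= v.
  apply: le_trans hv; apply: le_trans (od_residual_variance gamma_gt0 _ _) _.
  - by move=> i _; exact: od_z_sqr_le.
  - by rewrite invr_ge0 sqr_ge0.
  - rewrite lerD2r ler_sqr ?nnegrE ?(ltW gamma_gt0) ?(ltW (od_residual_gt0 _ gamma_gt0 n))//.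
    exact: od_residual_le_gamma.
have B2 : B ^+ 2 <= 2 * (gamma * Q2).
  have /andP[k0 k1] := od_shrinkage_bound; rewrite -/k in k0 k1.
  have MS : M ^+ 2 / S <= 2 * Q2.
    have -> : 2 * Q2 = M ^+ 2 * (2 / (1 + S)) by rewrite /Q2; ring.
    have S1 : 0 < 1 + S by rewrite addr_gt0.
    rewrite ler_wpM2l ?sqr_ge0// ler_pdivlMr// mulrDr mulVf ?gt_eqF// mulr1.
    by rewrite (_ : 2 = 1 + 1)// lerD2r invf_le1.
  have -> : B ^+ 2 = k ^+ 2 * (gamma * (M ^+ 2 / S)).
    rewrite /B !exprMn exprVn !sqr_sqrtr ?ltW//; ring.
  apply: (@le_trans _ _ (gamma * (M ^+ 2 / S))).
    rewrite ler_piMl ?expr_le1// mulr_ge0 ?divr_ge0 ?sqr_ge0 ?(ltW gamma_gt0)//.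
    exact: gram_ge0.
  by rewrite [leRHS]mulrCA ler_wpM2l// (ltW gamma_gt0).
have C2 : (Num.sqrt V * e n.+1) ^+ 2 <= v * e n.+1 ^+ 2.
  by rewrite exprMn sqr_sqrtr// ler_wpM2r ?sqr_ge0.
set C := Num.sqrt V * e n.+1 in C2 *.
have -> : a + B - (a + C) = B - C by ring.
by have := sqr_ge0 (B + C); rewrite !sqrrD ?sqrrN; nra.
Qed.

End od_trajectory.

(** * Moments of the autoregression *)

Lemma ge0_markov d (T : measurableType d) (R : realType) (P : probability T R)
    (f : T -> R) (c m : R) :
  measurable_fun setT f -> (forall t, 0 <= f t) -> 0 < c ->
  (\int[P]_t (f t)%:E <= m%:E -> P [set t | (c <= f t)%R] <= (m / c)%:E)%E.
Proof.
move=> mf f0 c0 hm.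
have mE : measurable [set t | c <= f t].
  rewrite -[X in measurable X]setTI; apply: measurable_fun_ler => //.
have -> : P [set t | c <= f t] = (\int[P]_t (\1_[set t | c <= f t] t)%:E)%E.
  by rewrite integral_indic// setIT.
apply: (@le_trans _ _ (\int[P]_t ((c^-1)%:E * (f t)%:E)))%E.
  apply: ge0_le_integral => //.
  - by apply/measurable_EFinP; exact: measurable_indic.
  - by apply/measurable_EFinP; exact: measurable_funM.
  - move=> t _; rewrite -EFinM lee_fin indicE.
    case: (boolP (t \in _)) => [|_] /=; last by rewrite mulr_ge0// invr_ge0 ltW.
    by rewrite inE /= => cf; rewrite mulrC ler_pdivlMr// mul1r.
rewrite ge0_integralZl//; last 3 first.
- exact/measurable_EFinP.
- by move=> t _; rewrite lee_fin.
- by rewrite lee_fin invr_ge0 ltW.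
by rewrite mulrC EFinM lee_wpmul2l// lee_fin invr_ge0 ltW.
Qed.

(** Away from 0 the inverse is a power of the absolute value up to sign; writing it
as [x * (x^2)^(-1)] avoids the discontinuity at 0, where both sides vanish. *)
Lemma measurable_invr (R : realType) :
  measurable_fun setT (fun x : R => x^-1).
Proof.
have -> : (fun x : R => x^-1) = (fun x : R => x * (x ^+ 2) `^ (-1)).
  apply/funext => x; rewrite powR_inv1 ?sqr_ge0//.
  have [->|x0] := eqVneq x 0; first by rewrite invr0 mul0r.
  by rewrite expr2 invfM mulrA divff// mul1r.
apply: measurable_funM => //.
by apply: (measurableT_comp (measurable_powR (-1))); exact: measurable_funX.
Qed.

Section autoregression.
Context d (T : measurableType d) (R : realType) (P : probability T R).
Variable eps : nat -> {RV P >-> R}.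
Local Notation N01 := (normal_prob (0 : R) (1 : R)).
Local Notation R' := (measurableTypeR R).
Hypothesis eps_indep : mutually_independent [set i : nat | (1 <= i)%N] eps.
Hypothesis eps_law : forall i, (1 <= i)%N -> has_law (eps i) N01.

Let gfub n d' (V : measurableType d') (U : T -> V) (h : V * R' -> \bar R) :=
  @adapted_fubini _ _ _ _ _ _ eps_indep eps_law n d' V U h.

(* The second factor carries the display of Lebesgue measure, under which the
measurable sets are the same; only unfolding identifies the two structures. *)
Let msnd d' (V : measurableType d') :
  measurable_fun setT (fun q : V * R' => q.2 : R).
Proof. by move=> _ A mA; exact: (measurable_snd measurableT). Qed.

Lemma adapted_second_moment n (u b : T -> R) :
  adapted eps n u -> adapted eps n b ->
  (\int[P]_t ((u t + b t * eps n.+1 t) ^+ 2)%:E <=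
   \int[P]_t (u t ^+ 2 + 6 * b t ^+ 2)%:E)%E.
Proof.
move=> au ab.
have aU : adapted eps n (fun t => (u t, b t)) by exact: measurable_fun_pair.
pose h (q : (R * R) * R') : \bar R := ((q.1.1 + q.1.2 * (q.2 : R)) ^+ 2)%:E.
have mh : measurable_fun setT h.
  apply/measurable_EFinP; apply: measurable_funX; apply: measurable_funD.
    exact: (measurableT_comp measurable_fst).
  by apply: measurable_funM => //; exact: (measurableT_comp measurable_snd).
have h0 q : (0 <= h q)%E by rewrite lee_fin sqr_ge0.
rewrite [leLHS](_ : _ = \int[P]_t h ((u t, b t), eps n.+1 t))%E; last reflexivity.
have mu := adapted_measurable au; have mb := adapted_measurable ab.
rewrite (gfub aU mh h0); apply: ge0_le_integral => //.
- by move=> t _; apply: integral_ge0.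
- apply: (measurableT_comp (measurable_fun_fubini_tonelli_F h mh h0)).
  exact: measurable_fun_pair.
- apply/measurable_EFinP; apply: measurable_funD; first exact: measurable_funX.
  by apply: measurable_funM => //; exact: measurable_funX.
- by move=> t _; exact: normal_second_moment_affine.
Qed.

(** The conditional form of [integral_expR_sqr_normal]. It exchanges the quadratic
weight on [y n.+1] for one on [y n], which sets up the recursions that compute
exponential moments of the series. *)
Lemma adapted_expR_sqr n (f u : T -> R) (k : R) :
  adapted eps n f -> adapted eps n u -> - (1 / 2) < k ->
  (\int[P]_t (expR (f t - k * (u t + eps n.+1 t) ^+ 2))%:E =
   ((Num.sqrt (1 + 2 * k))^-1)%:E *
   \int[P]_t (expR (f t - k / (1 + 2 * k) * u t ^+ 2))%:E)%E.
Proof.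
move=> af au kgt.
have aU : adapted eps n (fun t => (f t, u t)) by exact: measurable_fun_pair.
pose h (q : (R * R) * R') : \bar R :=
  (expR (q.1.1 - k * (q.1.2 + (q.2 : R)) ^+ 2))%:E.
have mh : measurable_fun setT h.
  apply/measurable_EFinP; apply: measurableT_comp => //.
  apply: measurable_funB; first exact: (measurableT_comp measurable_fst).
  apply: measurable_funM => //; apply: measurable_funX.
  by apply: measurable_funD => //; exact: (measurableT_comp measurable_snd).
transitivity (\int[P]_t h ((f t, u t), eps n.+1 t))%E; first reflexivity.
have mf := adapted_measurable af; have mu := adapted_measurable au.
have h0 q : (0 <= h q)%E by rewrite lee_fin expR_ge0.
rewrite (gfub aU mh h0).
rewrite -ge0_integralZl//; last first.
  apply/measurable_EFinP; apply: measurableT_comp => //.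
  by apply: measurable_funB => //; apply: measurable_funM => //; exact: measurable_funX.
apply: eq_integral => t _; rewrite /h /=.
under eq_integral do rewrite expRD EFinM.
rewrite ge0_integralZl//; last first.
  apply/measurable_EFinP; apply: measurableT_comp => //.
  apply: measurableT_comp => //; apply: measurable_funM => //.
  by apply: measurable_funX; exact: measurable_funD.
rewrite integral_expR_sqr_normal// -!EFinM; congr EFin.
by rewrite expRD; ring.
Qed.

Variables (theta : R) (y : nat -> T -> R).
Hypothesis theta2 : theta ^+ 2 <= 1.
Hypothesis y0 : forall t, y 0%N t = 0.
Hypothesis yE : forall i t, (1 <= i)%N -> y i t = theta * y i.-1 t + eps i t.

Local Notation S := (fun m t => gram (y^~ t) m).

Lemma adapted_y i : adapted eps i (y i).
Proof.
elim: i => [|i IH].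
  have -> : y 0%N = cst 0 by apply/funext => t; exact: y0.
  exact: measurable_cst.
have -> : y i.+1 = (fun t => theta * y i t + eps i.+1 t).
  by apply/funext => t; rewrite yE.
apply: measurable_funD; last by apply: adapted_eps; rewrite leqnn.
by apply: measurable_funM => //; exact: adapted_le IH.
Qed.

Lemma measurable_y i : measurable_fun setT (y i).
Proof. exact: (adapted_measurable (@adapted_y i)). Qed.

Lemma adapted_gram m : adapted eps m (S m.+1).
Proof.
apply: measurable_sum_nat => i /andP[i1 im]; apply: measurable_funX.
by apply: adapted_le (@adapted_y i.-1); rewrite -ltnS prednK.
Qed.

Lemma measurable_gram m : measurable_fun setT (S m).
Proof.
case: m => [|m]; last exact: (adapted_measurable (@adapted_gram m)).
by rewrite /gram; under eq_fun do rewrite big_geq//; exact: measurable_cst.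
Qed.

Lemma second_moment_y i :
  (\int[P]_t (y i t ^+ 2)%:E <= (6 * i%:R)%:E)%E.
Proof.
elim: i => [|i IH].
  by rewrite mulr0 integral0_eq// => t _; rewrite y0 expr0n.
under eq_integral do rewrite yE//=.
apply: (@le_trans _ _ (\int[P]_t (y i t ^+ 2 + 6)%:E))%E.
  apply: (@le_trans _ _ (\int[P]_t ((theta * y i t) ^+ 2 + 6 * 1 ^+ 2)%:E))%E.
    under eq_integral do rewrite -[eps i.+1 _]mul1r.
    apply: (@adapted_second_moment i (fun t => theta * y i t) (fun=> 1)) => //.
      by apply: measurable_funM => //; exact: adapted_y.
    exact: measurable_cst.
  apply: ge0_le_integral => //.
  - by move=> t _; rewrite lee_fin addr_ge0 ?sqr_ge0// mulr_ge0 ?sqr_ge0.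
  - apply/measurable_EFinP; apply: measurable_funD => //; apply: measurable_funX.
    by apply: measurable_funM => //; exact: measurable_y.
  - apply/measurable_EFinP; apply: measurable_funD => //; apply: measurable_funX.
    exact: measurable_y.
  - move=> t _; rewrite lee_fin expr1n mulr1 lerD2r exprMn ler_piMl ?sqr_ge0//.
under eq_integral do rewrite EFinD.
rewrite ge0_integralD//; last 2 first.
- by move=> t _; rewrite lee_fin sqr_ge0.
- by apply/measurable_EFinP; apply: measurable_funX; exact: measurable_y.
rewrite integral_cst//= probability_setT mule1.
rewrite (_ : 6 * i.+1%:R = 6 * i%:R + 6); last by rewrite -natr1; ring.
by rewrite [leRHS]EFinD leeD2r.
Qed.

Lemma mean_gram m : (\int[P]_t (S m t)%:E <= (6 * m%:R ^+ 2)%:E)%E.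
Proof.
elim: m => [|m IH].
  by rewrite expr0n mulr0 integral0_eq// => t _; rewrite /gram big_geq.
under eq_integral do rewrite gramS EFinD.
rewrite ge0_integralD//; last 4 first.
- by move=> t _; rewrite lee_fin gram_ge0.
- by apply/measurable_EFinP; exact: measurable_gram.
- by move=> t _; rewrite lee_fin sqr_ge0.
- by apply/measurable_EFinP; apply: measurable_funX; exact: measurable_y.
apply: le_trans (leeD IH (second_moment_y m)) _.
rewrite -EFinD lee_fin -natr1.
by have : 0 <= m%:R :> R by []; nra.
Qed.

End autoregression.

(** * The self-normalized noise *)

Section autoregression_bounds.
Context d (T : measurableType d) (R : realType) (P : probability T R).
Variable eps : nat -> {RV P >-> R}.
Local Notation N01 := (normal_prob (0 : R) (1 : R)).
Hypothesis eps_indep : mutually_independent [set i : nat | (1 <= i)%N] eps.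
Hypothesis eps_law : forall i, (1 <= i)%N -> has_law (eps i) N01.
Variables (theta : R) (y : nat -> T -> R).
Hypothesis theta2 : theta ^+ 2 <= 1.
Hypothesis y0 : forall t, y 0%N t = 0.
Hypothesis yE : forall i t, (1 <= i)%N -> y i t = theta * y i.-1 t + eps i t.

Local Notation S := (fun m t => gram (y^~ t) m).

Let ay i : adapted eps i (y i).
Proof. exact: (adapted_y y0 yE). Qed.
Let agram m : adapted eps m (S m.+1).
Proof. exact: (adapted_gram y0 yE). Qed.
Let my i : measurable_fun setT (y i).
Proof. exact: (measurable_y y0 yE). Qed.
Let mgram m : measurable_fun setT (S m).
Proof. exact: (measurable_gram y0 yE). Qed.

Let M m t := \sum_(1 <= i < m.+1) y i.-1 t * eps i t.
Definition self_normalized m t : R :=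
  (\sum_(1 <= i < m.+1) y i.-1 t * eps i t) ^+ 2 / (1 + S m t).

Let D m t := \sum_(1 <= i < m.+1) y i.-1 t ^+ 2 / (1 + S i t).

Let S1 m t : 0 < 1 + S m t.
Proof. by rewrite ltr_wpDr// gram_ge0. Qed.

Let aM m : adapted eps m (M m).
Proof.
apply: measurable_sum_nat => i /andP[i1 im]; apply: measurable_funM.
  by apply: adapted_le (@ay i.-1); rewrite -ltnS prednK// ltnW.
by apply: adapted_eps; rewrite i1.
Qed.

Let mM m : measurable_fun setT (M m).
Proof. exact: (adapted_measurable (@aM m)). Qed.

Let minv (f : T -> R) : measurable_fun setT f -> measurable_fun setT (fun t => (f t)^-1).
Proof. by move=> mf; exact: (measurableT_comp (@measurable_invr R)). Qed.

Lemma measurable_self_normalized m :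
  measurable_fun setT (self_normalized m).
Proof.
apply: measurable_funM; first by apply: measurable_funX; exact: mM.
by apply: minv; exact: measurable_funD.
Qed.

Let mD m : measurable_fun setT (D m).
Proof.
apply: measurable_sum_nat => i _; apply: measurable_funM.
  exact: measurable_funX.
by apply: minv; exact: measurable_funD.
Qed.

Lemma self_normalized_ge0 m t : 0 <= self_normalized m t.
Proof. by rewrite divr_ge0 ?sqr_ge0// ltW. Qed.

Let D0 m t : 0 <= D m t.
Proof. by apply: sumr_ge0 => i _; rewrite divr_ge0 ?sqr_ge0// ltW. Qed.

(** With [c = (1 + S m.+1)^(-1/2)], which is known at time [m], the self-normalized
sum at time [m.+1] is the square of [M m * c + y m * c * eps m.+1]; the first term
is smaller than at time [m], as the Gram sum increases. *)
Lemma mean_self_normalized_le m :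
  (\int[P]_t (self_normalized m t)%:E <= \int[P]_t (6 * D m t)%:E)%E.
Proof.
elim: m => [|m IH].
  rewrite integral0_eq; first by apply: integral_ge0 => t _; rewrite lee_fin mulr_ge0.
  by move=> t _; rewrite /self_normalized big_geq// expr0n mul0r.
pose c t := (Num.sqrt (1 + S m.+1 t))^-1.
have ac : adapted eps m c.
  apply: (measurableT_comp (@measurable_invr R)).
  apply: (measurableT_comp (@measurable_sqrt R)).
  by apply: measurable_funD; [exact: measurable_cst|exact: agram].
have c2 t : c t ^+ 2 = (1 + S m.+1 t)^-1.
  by rewrite /c exprVn sqr_sqrtr// ltW.
pose u t := M m t * c t; pose b t := y m t * c t.
have au : adapted eps m u by apply: measurable_funM => //; exact: aM.
have ab : adapted eps m b by apply: measurable_funM => //; exact: ay.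
have -> : (\int[P]_t (self_normalized m.+1 t)%:E = \int[P]_t ((u t + b t * eps m.+1 t) ^+ 2)%:E)%E.
  apply: eq_integral => t _; congr EFin.
  by rewrite /self_normalized -c2 /u /b /M big_nat_recr//=; ring.
apply: le_trans (adapted_second_moment eps_indep eps_law au ab) _.
apply: (@le_trans _ _ (\int[P]_t ((self_normalized m t)%:E + (6 * b t ^+ 2)%:E))%E).
  apply: ge0_le_integral => //.
  - by move=> t _; rewrite lee_fin addr_ge0 ?sqr_ge0// mulr_ge0 ?sqr_ge0.
  - apply/measurable_EFinP; have mu := adapted_measurable au.
    have mb := adapted_measurable ab.
    apply: measurable_funD; first exact: measurable_funX.
    by apply: measurable_funM => //; exact: measurable_funX.
  - apply: emeasurable_funD; apply/measurable_EFinP.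
      exact: measurable_self_normalized.
    apply: measurable_funM => //; apply: measurable_funX.
    exact: (adapted_measurable ab).
  - move=> t _; rewrite -EFinD lee_fin lerD2r /u /self_normalized exprMn c2.
    rewrite ler_wpM2l ?sqr_ge0// lef_pV2 ?posrE// lerD2l.
    exact: gram_le.
rewrite ge0_integralD//; last 4 first.
- by move=> t _; rewrite lee_fin self_normalized_ge0.
- by apply/measurable_EFinP; exact: measurable_self_normalized.
- by move=> t _; rewrite lee_fin mulr_ge0 ?sqr_ge0.
- apply/measurable_EFinP; apply: measurable_funM => //; apply: measurable_funX.
  exact: (adapted_measurable ab).
apply: (@le_trans _ _ (\int[P]_t (6 * D m t)%:E + \int[P]_t (6 * b t ^+ 2)%:E)%E).
  by rewrite leeD2r.
rewrite -ge0_integralD//; last 4 first.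
- by move=> t _; rewrite lee_fin mulr_ge0.
- by apply/measurable_EFinP; apply: measurable_funM.
- by move=> t _; rewrite lee_fin mulr_ge0 ?sqr_ge0.
- apply/measurable_EFinP; apply: measurable_funM => //; apply: measurable_funX.
  exact: (adapted_measurable ab).
rewrite le_eqVlt; apply/orP; left; apply/eqP.
apply: eq_integral => t _; rewrite -EFinD; congr EFin.
by rewrite /D [in RHS]big_nat_recr//= /b exprMn c2; ring.
Qed.

Let D_le_ln m t : D m t <= ln (1 + S m t).
Proof.
elim: m => [|m IH].
  by rewrite /D big_geq// ln_ge0// lerDl gram_ge0.
rewrite /D big_nat_recr//= -/(D m t).
have := expR_ge1Dx (ln ((1 + S m t) / (1 + S m.+1 t))).
rewrite lnK ?posrE ?divr_gt0// ln_div ?posrE//.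
have -> : (1 + S m t) / (1 + S m.+1 t) = 1 - y m t ^+ 2 / (1 + S m.+1 t).
  by have := S1 m.+1 t; rewrite gramS => h; field; rewrite gt_eqF.
lra.
Qed.

(** The sum [D] is dominated by [ln (1 + S)], and the tangent to the logarithm at
[m^2] reduces the mean of that logarithm to the mean of [S], which is of order at
most [m^2]. *)
Lemma mean_self_normalized m : (0 < m)%N ->
  (\int[P]_t (self_normalized m t)%:E <= (12 * ln m%:R + 42)%:E)%E.
Proof.
move=> m0; apply: le_trans (mean_self_normalized_le m) _.
have m2 : 0 < m%:R ^+ 2 :> R by rewrite exprn_gt0// ltr0n.
have lm : 0 <= ln m%:R :> R by rewrite ln_ge0// ler1n.
apply: (@le_trans _ _ (\int[P]_t ((12 * ln m%:R + 6)%:E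
     + (6 / m%:R ^+ 2)%:E * (S m t)%:E))%E).
  apply: ge0_le_integral => //.
  - by move=> t _; rewrite lee_fin mulr_ge0.
  - by apply/measurable_EFinP; exact: measurable_funM.
  - apply: emeasurable_funD => //; apply: emeasurable_funM => //.
    by apply/measurable_EFinP.
  - move=> t _; rewrite -EFinM -EFinD lee_fin.
    have h1 := D_le_ln m t.
    have := expR_ge1Dx (ln ((1 + S m t) / m%:R ^+ 2)).
    rewrite lnK ?posrE ?divr_gt0// ln_div ?posrE// lnXn ?ltr0n// mulr2n => h2.
    have h3 : (1 + S m t) / m%:R ^+ 2 <= 1 + S m t / m%:R ^+ 2.
      by rewrite mulrDl mul1r lerD2r invf_le1// exprn_ege1// ler1n.
    have -> : 6 / m%:R ^+ 2 * S m t = 6 * (S m t / m%:R ^+ 2) by ring.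
    lra.
rewrite ge0_integralD//; last 3 first.
- by move=> t _; rewrite lee_fin; lra.
- by move=> t _; rewrite mule_ge0 ?lee_fin ?divr_ge0 ?gram_ge0 ?(ltW m2).
- by apply: emeasurable_funM => //; apply/measurable_EFinP.
rewrite integral_cst//= probability_setT mule1 ge0_integralZl//; last 2 first.
- exact/measurable_EFinP.
- by move=> t _; rewrite lee_fin gram_ge0.
apply: (@le_trans _ _ ((12 * ln m%:R + 6)%:E + (6 / m%:R ^+ 2)%:E * (6 * m%:R ^+ 2)%:E)%E).
  rewrite leeD2l// lee_wpmul2l ?lee_fin ?divr_ge0 ?(ltW m2)//.
  exact: (mean_gram eps_indep eps_law theta2 y0 yE).
rewrite -EFinM -EFinD lee_fin.
have -> : 6 / m%:R ^+ 2 * (6 * m%:R ^+ 2) = 36 :> R by field; rewrite gt_eqF// ltr0n.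
lra.
Qed.

End autoregression_bounds.

(** * Exponential moments and tails *)

Section small_ball_coefficients.
Context (R : realType).
Variables lambda theta : R.
Hypothesis lambda0 : 0 <= lambda.

(** The coefficient of the square of the last remaining value, after [j] noise
variables were integrated out of [exp (- lambda * S)]. *)
Fixpoint ball_coef j : R :=
  if j is k.+1 then
    lambda + theta ^+ 2 * (ball_coef k / (1 + 2 * ball_coef k))
  else 0.

Lemma ball_coef_ge0 j : 0 <= ball_coef j.
Proof.
elim: j => [|j IH] //=; apply: addr_ge0 => //; apply: mulr_ge0; first exact: sqr_ge0.
by rewrite divr_ge0// addr_ge0// mulr_ge0.
Qed.

Lemma ball_coef_ge_lambda j : lambda <= ball_coef j.+1.
Proof.
rewrite /= lerDl; apply: mulr_ge0; first exact: sqr_ge0.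
by rewrite divr_ge0 ?addr_ge0 ?mulr_ge0 ?ball_coef_ge0.
Qed.

End small_ball_coefficients.

(** For a unit root the recursion [c' = lambda + c / (1 + 2 c)] first grows linearly
with slope at least [lambda / 2], and then stays above half the square root of
[lambda]; the turning point is at [j = q] when [lambda = 1 / q^2]. *)
Lemma ball_coef_unit_root (R : realType) (theta : R) (q j : nat) :
  theta ^+ 2 = 1 -> (0 < q)%N ->
  (minn j q)%:R / (2 * q%:R ^+ 2) <= ball_coef (q%:R ^+ 2)^-1 theta j.
Proof.
move=> th1 q0; set l : R := (q%:R ^+ 2)^-1.
have Q0 : 0 < q%:R :> R by rewrite ltr0n.
have l0 : 0 <= l by rewrite invr_ge0 sqr_ge0.
elim: j => [|j IH]; first by rewrite min0n mul0r.
rewrite /= th1 mul1r; have c0 := ball_coef_ge0 theta l0 j.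
set c := ball_coef _ _ j in IH c0 *; set x := _ / _ in IH.
have x0 : 0 <= x by rewrite divr_ge0// mulr_ge0// sqr_ge0.
have xq : x <= (2 * q%:R)^-1.
  rewrite /x ler_pdivrMr ?mulr_gt0 ?exprn_gt0//.
  have -> : (2 * q%:R)^-1 * (2 * q%:R ^+ 2) = q%:R :> R by field; rewrite gt_eqF.
  by rewrite ler_nat geq_minr.
have hc : x - 2 * x ^+ 2 <= c / (1 + 2 * c).
  rewrite ler_pdivlMr; last by lra.
  rewrite -subr_ge0 [leRHS](_ : _ =
    (c - x) * ((1 - x) ^+ 2 + 3 * x ^+ 2) + 4 * x ^+ 3); last by ring.
  apply: addr_ge0; last by rewrite mulr_ge0// exprn_ge0.
  apply: mulr_ge0; first by rewrite subr_ge0.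
  by rewrite addr_ge0 ?sqr_ge0// mulr_ge0// sqr_ge0.
have x2 : 2 * x ^+ 2 <= l / 2.
  have -> : l / 2 = 2 * (2 * q%:R)^-1 ^+ 2 by rewrite /l; field; rewrite gt_eqF.
  by rewrite ler_wpM2l// ler_sqr ?nnegrE// invr_ge0 mulr_ge0// ltW.
apply: (@le_trans _ _ (x + l / 2)); last by lra.
have -> : l / 2 = 1 / (2 * q%:R ^+ 2) by rewrite /l; field; rewrite gt_eqF.
rewrite -mulrDl ler_pM2r ?invr_gt0 ?mulr_gt0 ?exprn_gt0//.
by rewrite natr1 ler_nat; lia.
Qed.

Section exponential_moments.
Context d (T : measurableType d) (R : realType) (P : probability T R).
Variable eps : nat -> {RV P >-> R}.
Local Notation N01 := (normal_prob (0 : R) (1 : R)).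
Hypothesis eps_indep : mutually_independent [set i : nat | (1 <= i)%N] eps.
Hypothesis eps_law : forall i, (1 <= i)%N -> has_law (eps i) N01.
Variables (theta : R) (y : nat -> T -> R).
Hypothesis y0 : forall t, y 0%N t = 0.
Hypothesis yE : forall i t, (1 <= i)%N -> y i t = theta * y i.-1 t + eps i t.

Local Notation S := (fun m t => gram (y^~ t) m).

Let ay i : adapted eps i (y i).
Proof. exact: (adapted_y y0 yE). Qed.
Let agram m : adapted eps m (S m.+1).
Proof. exact: (adapted_gram y0 yE). Qed.
Let my i : measurable_fun setT (y i).
Proof. exact: (measurable_y y0 yE). Qed.
Let mgram m : measurable_fun setT (S m).
Proof. exact: (measurable_gram y0 yE). Qed.

Let agram' m : adapted eps m (S m).
Proof.
case: m => [|m]; last by apply: adapted_le (@agram m).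
rewrite /gram; have -> : (fun t => \sum_(1 <= i < 1) y i.-1 t ^+ 2) = cst 0.
  by apply/funext => t; rewrite big_geq.
exact: measurable_cst.
Qed.

Section upper_tail.
(* Any supersolution of the recursion for the variances of the series. *)
Variable tau : nat -> R.
Hypothesis tau0 : 0 <= tau 0%N.
Hypothesis tauS : forall i, theta ^+ 2 * tau i + 1 <= tau i.+1.

Let tau_ge0 i : 0 <= tau i.
Proof.
elim: i => [//|i IH]; apply: le_trans (tauS i).
by rewrite addr_ge0// mulr_ge0// sqr_ge0.
Qed.

(** Equality holds for a centred normal variable of variance [tau i]; the right-hand
side is preserved by [adapted_expR_sqr], which replaces [k] by
[k * theta^2 / (1 - 2 k)]. *)
Lemma mean_expR_sqr_y i (k : R) : 0 <= k -> 2 * k * tau i < 1 ->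
  (\int[P]_t (expR (k * y i t ^+ 2))%:E <=
   ((Num.sqrt (1 - 2 * k * tau i))^-1)%:E)%E.
Proof.
elim: i k => [|i IH] k k0 kt.
  under eq_integral do rewrite y0 expr0n mulr0 expR0.
  rewrite integral_cst//= probability_setT mule1 lee_fin.
  rewrite invf_ge1 ?sqrtr_gt0; last by lra.
  rewrite -[leRHS]sqrtr1 ler_wsqrtr// lerBlDr lerDl.
  by rewrite !mulr_ge0.
have ts := tauS i; have t0 := tau_ge0 i.
have th0 : 0 <= theta ^+ 2 by exact: sqr_ge0.
have tt0 : 0 <= theta ^+ 2 * tau i by exact: mulr_ge0.
have k1 : 2 * k < 1.
  apply: le_lt_trans kt; rewrite ler_peMr ?mulr_ge0//.
  by apply: le_trans ts; lra.
have k10 : 0 < 1 - 2 * k by lra.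
pose k' := k * theta ^+ 2 / (1 - 2 * k).
have k'0 : 0 <= k' by apply: divr_ge0; [exact: mulr_ge0|exact: ltW].
have kts : 2 * k * (theta ^+ 2 * tau i + 1) < 1.
  by apply: le_lt_trans kt; rewrite ler_wpM2l// mulr_ge0.
have k't : 2 * k' * tau i < 1.
  have -> : 2 * k' * tau i = (2 * k * (theta ^+ 2 * tau i)) / (1 - 2 * k).
    by rewrite /k'; field; rewrite gt_eqF.
  by rewrite ltr_pdivrMr//; lra.
have au : adapted eps i (fun t => theta * y i t).
  by apply: measurable_funM => //; exact: ay.
have a0 : adapted eps i (fun=> 0 : R) by exact: measurable_cst.
have kgt : - (1 / 2) < - k by lra.
have -> : (\int[P]_t (expR (k * y i.+1 t ^+ 2))%:E =
    \int[P]_t (expR (0 - - k * (theta * y i t + eps i.+1 t) ^+ 2))%:E)%E.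
  apply: eq_integral => t _; congr (expR _)%:E.
  by rewrite yE//= sub0r mulNr opprK.
rewrite (adapted_expR_sqr eps_indep eps_law a0 au kgt).
have -> : (\int[P]_t (expR (0 - - k / (1 + 2 * - k) * (theta * y i t) ^+ 2))%:E =
    \int[P]_t (expR (k' * y i t ^+ 2))%:E)%E.
  apply: eq_integral => t _; congr (expR _)%:E.
  by rewrite /k'; field; rewrite gt_eqF//; lra.
apply: (@le_trans _ _ (((Num.sqrt (1 + 2 * - k))^-1)%:E *
    ((Num.sqrt (1 - 2 * k' * tau i))^-1)%:E)%E).
  by rewrite lee_wpmul2l ?IH// lee_fin invr_ge0 sqrtr_ge0.
rewrite -EFinM lee_fin -invfM -sqrtrM; last by lra.
have -> : (1 + 2 * - k) * (1 - 2 * k' * tau i) =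
    1 - 2 * k * (theta ^+ 2 * tau i + 1).
  by rewrite /k'; field; rewrite gt_eqF//; lra.
rewrite lef_pV2 ?posrE ?sqrtr_gt0; [|lra|lra].
rewrite ler_wsqrtr// lerD2l lerN2 ler_wpM2l//.
by rewrite mulr_ge0.
Qed.

(** The Chernoff bound at [k = 1 / (4 s)], where the exponential moment is at most
the square root of 2. *)
Lemma tail_y i (s a : R) : 0 < s -> tau i <= s ->
  (P [set t | (a <= y i t ^+ 2)%R] <= (2 * expR (- (a / (4 * s))))%:E)%E.
Proof.
move=> s0 ts; pose k := (4 * s)^-1.
have k0 : 0 < k by rewrite invr_gt0 mulr_gt0.
have kt : 2 * k * tau i <= 1 / 2.
  apply: (@le_trans _ _ (2 * k * s)); first by rewrite ler_wpM2l// mulr_ge0// ltW.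
  by rewrite (_ : 2 * k * s = 1 / 2)// /k; field; rewrite gt_eqF.
have h : (\int[P]_t (expR (k * y i t ^+ 2))%:E <= 2%:E)%E.
  apply: le_trans (mean_expR_sqr_y (ltW k0) _) _; first by lra.
  rewrite lee_fin invf_ple ?posrE ?sqrtr_gt0//; last by lra.
  rewrite -[leLHS]ger0_norm ?invr_ge0// -sqrtr_sqr ler_wsqrtr//.
  have : (2^-1 : R) ^+ 2 = 1 / 4 by field.
  lra.
have mf : measurable_fun setT (fun t => expR (k * y i t ^+ 2)).
  apply: measurableT_comp => //; apply: measurable_funM => //.
  exact: measurable_funX.
have e0 t : 0 <= expR (k * y i t ^+ 2) by exact: expR_ge0.
have := ge0_markov mf e0 (expR_gt0 (k * a)) h.
rewrite -expRN; have -> : k * a = a / (4 * s) by rewrite mulrC.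
apply: le_trans; rewrite le_eqVlt; apply/orP; left; apply/eqP; congr (P _).
apply/seteqP; split=> t /=; rewrite ler_expR [in (a / _)]mulrC ler_pM2l//.
Qed.

End upper_tail.

Section lower_tail.
Variable lambda : R.
Hypothesis lambda0 : 0 < lambda.
Local Notation c := (ball_coef lambda theta).

(* The Laplace transform at the stage where [m] noise variables are left. *)
Let F m j := (\int[P]_t (expR (- (lambda * S m t) - c j * y m t ^+ 2))%:E)%E.

Let FS m j : (F m.+1 j = ((Num.sqrt (1 + 2 * c j))^-1)%:E * F m j.+1)%E.
Proof.
have c0 := ball_coef_ge0 theta (ltW lambda0) j.
have au : adapted eps m (fun t => theta * y m t).
  by apply: measurable_funM => //; exact: ay.
have af : adapted eps m (fun t => - (lambda * S m.+1 t)).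
  apply: measurableT_comp => //; apply: measurable_funM => //; exact: agram.
have -> : F m.+1 j = (\int[P]_t (expR (- (lambda * S m.+1 t) -
    c j * (theta * y m t + eps m.+1 t) ^+ 2))%:E)%E.
  by apply: eq_integral => t _; rewrite yE.
rewrite (adapted_expR_sqr eps_indep eps_law af au); last by lra.
congr (_ * _)%E; apply: eq_integral => t _; congr (expR _)%:E.
by rewrite gramS /=; ring.
Qed.

Let F_ge0 m j : (0 <= F m j)%E.
Proof. by apply: integral_ge0 => t _; rewrite lee_fin expR_ge0. Qed.

(** Each integration contributes a factor [(1 + 2 c j)^(-1/2)]; the first [j0] of
them are bounded by 1. *)
Lemma mean_expR_gram (j0 m : nat) (cs : R) : 0 <= cs ->
  (forall j, (j0 <= j)%N -> cs <= c j) ->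
  (\int[P]_t (expR (- (lambda * S (m + j0)%N t)))%:E <=
   ((Num.sqrt (1 + 2 * cs))^-1 ^+ m)%:E)%E.
Proof.
move=> cs0 hcs.
have fac j : 0 <= (Num.sqrt (1 + 2 * c j))^-1 :> R by rewrite invr_ge0 sqrtr_ge0.
have fac1 j : (Num.sqrt (1 + 2 * c j))^-1 <= 1 :> R.
  have c0 := ball_coef_ge0 theta (ltW lambda0) j.
  rewrite invf_le1 ?sqrtr_gt0; last by lra.
  by rewrite -[leLHS]sqrtr1 ler_wsqrtr//; lra.
have F1 k j : (j0 <= j)%N -> (F k j <= ((Num.sqrt (1 + 2 * cs))^-1 ^+ k)%:E)%E.
  elim: k j => [|k IH] j jj.
    rewrite /F expr0; under eq_integral do
      rewrite y0 expr0n mulr0 subr0 /gram big_geq// mulr0 oppr0 expR0.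
    by rewrite integral_cst//= probability_setT mule1.
  rewrite FS exprS EFinM; apply: lee_pmul.
  - by rewrite lee_fin; exact: fac.
  - exact: F_ge0.
  - have c0 := hcs j jj; rewrite lee_fin lef_pV2 ?posrE ?sqrtr_gt0; [|lra|lra].
    by rewrite ler_wsqrtr//; lra.
  - by apply: IH; exact: leqW.
have F2 k j : (F (k + j)%N 0 <= F k j)%E.
  elim: j k => [|j IH] k; first by rewrite addn0.
  rewrite addnS -addSn; apply: le_trans (IH k.+1) _; rewrite FS.
  rewrite -[leRHS]mul1e; apply: lee_pmul.
  - by rewrite lee_fin; exact: fac.
  - exact: F_ge0.
  - by rewrite lee_fin; exact: fac1.
  - exact: lexx.
apply: le_trans (F1 m j0 (leqnn _)); apply: le_trans (F2 m j0).
rewrite le_eqVlt; apply/orP; left; apply/eqP; apply: eq_integral => t _.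
by rewrite /= mul0r subr0.
Qed.

(** Markov's inequality for [exp (- lambda * S)] at the level [S = 1 / lambda], and
Bernoulli's inequality for the power of [1 + 2 * cs]. *)
Lemma small_ball_gram (j0 m : nat) (cs : R) : 0 <= cs ->
  (forall j, (j0 <= j)%N -> cs <= c j) ->
  (P [set t | (S (m + j0)%N t <= lambda^-1)%R] <=
   (expR 1 / Num.sqrt (1 + 2 * cs * m%:R))%:E)%E.
Proof.
move=> cs0 hcs; pose f t := expR (- (lambda * S (m + j0)%N t)).
have mf : measurable_fun setT f.
  apply: measurableT_comp => //; apply: measurableT_comp => //.
  by apply: measurable_funM.
have f0 t : 0 <= f t by exact: expR_ge0.
have := ge0_markov mf f0 (expR_gt0 (- 1)) (mean_expR_gram m cs0 hcs).
have -> : [set t | expR (-1) <= f t] = [set t | S (m + j0)%N t <= lambda^-1].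
  apply/seteqP; split=> t /=; rewrite ler_expR lerN2;
  by rewrite -[lambda^-1]mulr1 ler_pdivlMl.
move=> /le_trans; apply; rewrite lee_fin expRN invrK mulrC.
rewrite ler_wpM2l ?expR_ge0// exprVn.
have p0 : 0 < 1 + 2 * cs * m%:R.
  by rewrite ltr_wpDr// mulr_ge0// mulr_ge0.
have p1 : 0 < 1 + 2 * cs by lra.
rewrite lef_pV2 ?posrE ?exprn_gt0 ?sqrtr_gt0//.
rewrite -[leRHS]ger0_norm; last by rewrite exprn_ge0 ?sqrtr_ge0.
rewrite -sqrtr_sqr -exprM mulnC exprM sqr_sqrtr; last exact: ltW.
rewrite ler_wsqrtr//.
elim: m {mf f0 f p0} => [|k IH]; first by rewrite mulr0 addr0 expr0.
rewrite exprS -natr1; have kk : 0 <= cs * k%:R by exact: mulr_ge0.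
have : (1 + 2 * cs) * (1 + 2 * cs * k%:R) <= (1 + 2 * cs) * (1 + 2 * cs) ^+ k.
  by rewrite ler_wpM2l// ltW.
apply: le_trans; nra.
Qed.

End lower_tail.

End exponential_moments.

(** * Perturbation of a limit law *)

Section approximation.
Context d (T : measurableType d) (R : realType) (P : probability T R).

(** The distribution function of [X n] at [r] lies between those of [Z n] at [r - dl]
and [r + dl], up to the probability that the two variables are [dl] apart. *)
Lemma cvg_in_distribution_approx (X Z : nat -> T -> R)
    (mu : probability (measurableTypeR R) R) :
  (forall n, measurable_fun setT (X n)) ->
  (forall n, measurable_fun setT (Z n)) ->
  (\forall n \near \oo, forall A : set R, measurable A ->
     P (Z n @^-1` A) = mu A) ->
  (forall dl e : R, 0 < dl -> 0 < e -> \forall n \near \oo,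
     (P [set t | (dl <= `|X n t - Z n t|)%R] <= e%:E)%E) ->
  cvg_in_distribution P X mu.
Proof.
move=> mX mZ lawZ XZ; split=> // r rcont.
have mY n (Y : nat -> T -> R) : measurable_fun setT (Y n) ->
    forall x, measurable (Y n @^-1` `]-oo, x]).
  by move=> mYn x; rewrite -[X in measurable X]setTI; exact: mYn.
pose F x := fine (mu `]-oo, x]%classic).
have FE x : mu `]-oo, x]%classic = (F x)%:E.
  by rewrite fineK// fin_num_measure.
pose p n := fine (P (X n @^-1` `]-oo, r])).
have pE n : pushforward P (X n) `]-oo, r]%classic = (p n)%:E.
  by rewrite fineK// fin_num_measure//; exact: mY.
have pE' n : (p n)%:E = P (X n @^-1` `]-oo, r]) by exact/esym/pE.
under eq_cvg do rewrite pE.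
rewrite FE; apply: cvg_EFin; first exact: nearW.
have Fcont : F x @[x --> r] --> F r.
  have : (fun x => mu `]-oo, x]%classic) @ r --> mu `]-oo, r]%classic.
    exact: rcont.
  by rewrite (funext FE) FE => /fine_cvgP[].
apply/cvgrPdist_le => e e0.
have e20 : 0 < e / 2 by rewrite divr_gt0.
move/cvgrPdist_le : Fcont => /(_ _ e20) /nbhs_ballP[dl0 /= dl00 hdl].
pose dl := dl0 / 2; have dlgt : 0 < dl by rewrite divr_gt0.
have Fp : `|F r - F (r + dl)| <= e / 2.
  apply: hdl; rewrite /ball/= opprD addrA subrr sub0r normrN gtr0_norm//.
  by rewrite /dl; lra.
have Fm : `|F r - F (r - dl)| <= e / 2.
  apply: hdl; rewrite /ball/= opprB addrCA subrr addr0 gtr0_norm//.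
  by rewrite /dl; lra.
near=> n.
have small : (P [set t | (dl <= `|X n t - Z n t|)%R] <= (e / 2)%:E)%E.
  by near: n; exact: XZ.
have lawZn : forall A : set R, measurable A -> P (Z n @^-1` A) = mu A.
  by near: n.
have mD : measurable [set t | dl <= `|X n t - Z n t|].
  rewrite -[X in measurable X]setTI.
  apply: measurable_fun_ler => //; apply: measurableT_comp => //.
  exact: measurable_funB.
have up : p n <= F (r + dl) + e / 2.
  rewrite -lee_fin EFinD -FE pE' -lawZn//.
  pose E := (Z n @^-1` `]-oo, r + dl]) `|` [set t | dl <= `|X n t - Z n t|].
  apply: (@le_trans _ _ (P E)).
    apply: le_measure; rewrite ?inE; [exact: mY|apply: measurableU => //; exact: mY|].
    move=> t /=; rewrite in_itv/= => Xr.
    have [h|h] := leP dl `|X n t - Z n t|; first by right.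
    left; move: h; rewrite ltr_norml /= in_itv/= => /andP[h1 h2]; lra.
  apply: le_trans (measureU2 _ _ _) _ => //; first exact: mY.
  exact: leeD.
have lo : F (r - dl) <= p n + e / 2.
  rewrite -lee_fin EFinD -FE pE' -lawZn//.
  pose E := (X n @^-1` `]-oo, r]) `|` [set t | dl <= `|X n t - Z n t|].
  apply: (@le_trans _ _ (P E)).
    apply: le_measure; rewrite ?inE; [exact: mY|apply: measurableU => //; exact: mY|].
    move=> t /=; rewrite in_itv/= => Zr.
    have [h|h] := leP dl `|X n t - Z n t|; first by right.
    left; move: h; rewrite ltr_norml /= in_itv/= => /andP[h1 h2]; lra.
  apply: le_trans (measureU2 _ _ _) _ => //; first exact: mY.
  exact: leeD.
move: Fp Fm; rewrite !ler_norml => /andP[a1 a2] /andP[b1 b2].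
by apply/andP; split; lra.
Unshelve. all: by end_near. Qed.

End approximation.

Lemma near_ln_ge (R : realType) (B : R) : \forall n \near \oo, B <= ln n%:R.
Proof.
near=> n; have h : expR B <= n%:R by near: n; exact: nbhs_infty_ger.
by rewrite -ler_expR lnK// posrE (lt_le_trans (expR_gt0 B)).
Unshelve. all: by end_near. Qed.

Lemma near_lnln_ge (R : realType) (B : R) :
  \forall n \near \oo, B <= ln (ln n%:R).
Proof.
near=> n; have h : expR B <= ln n%:R by near: n; exact: near_ln_ge.
by rewrite -ler_expR lnK// posrE (lt_le_trans (expR_gt0 B)).
Unshelve. all: by end_near. Qed.

(** * The good event *)

(** The hypothesis on [A / s] makes the exponent at least [C l^2 / 5760] through
[exp l >= l^6 / 720], and for [l] large this exceeds [2 l]; the prefactor [exp l]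
is the number of indices in a union bound. Here [5760 = 8 * 720]. *)
Lemma union_tail_le (R : realType) (C l s A : R) :
  0 < C -> 1 <= l -> 2 * 5760 / C <= l -> 0 < s ->
  C * (expR l / l ^+ 2) <= A / s ->
  expR l * (2 * expR (- (A / (2 * l ^+ 2) / (4 * s)))) <= 2 / l.
Proof.
move=> C0 l1 lC s0 CA; have l0 : 0 < l by lra.
have l6 : l ^+ 6 / 720 <= expR l.
  have := expR_ge1Dxn 5 (ltW l0).
  by rewrite (_ : 6`! = 720)%N//; lra.
have h1 : C * l ^+ 2 / 5760 <= A / (2 * l ^+ 2) / (4 * s).
  have -> : A / (2 * l ^+ 2) / (4 * s) = A / s / (8 * l ^+ 2).
    by field; rewrite !gt_eqF.
  apply: (@le_trans _ _ (C * (expR l / l ^+ 2) / (8 * l ^+ 2))); last first.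
    by rewrite ler_wpM2r// invr_ge0 mulr_ge0// sqr_ge0.
  have -> : C * (expR l / l ^+ 2) / (8 * l ^+ 2) = C * (expR l / (8 * l ^+ 4)).
    by field; rewrite gt_eqF.
  rewrite -mulrA ler_wpM2l ?(ltW C0)// ler_pdivlMr ?mulr_gt0 ?exprn_gt0//.
  by apply: le_trans l6; rewrite le_eqVlt; apply/orP; left; apply/eqP; field.
have h2 : 2 * l <= C * l ^+ 2 / 5760.
  have : 2 * 5760 <= C * l by move: lC; rewrite ler_pdivrMr// [l * C]mulrC.
  by nra.
rewrite mulrCA -expRD ler_wpM2l//.
apply: (@le_trans _ _ (expR (- l))); first by rewrite ler_expR; lra.
rewrite expRN lef_pV2 ?posrE ?expR_gt0//.
by have := expR_ge1Dx l; lra.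
Qed.

Section good_event.
Context d (T : measurableType d) (R : realType) (P : probability T R).
Variable eps : nat -> {RV P >-> R}.
Local Notation N01 := (normal_prob (0 : R) (1 : R)).
Hypothesis eps_indep : mutually_independent [set i : nat | (1 <= i)%N] eps.
Hypothesis eps_law : forall i, (1 <= i)%N -> has_law (eps i) N01.
Variables (theta : R) (y : nat -> T -> R).
Hypothesis htheta : -1 < theta <= 1.
Hypothesis y0 : forall t, y 0%N t = 0.
Hypothesis yE : forall i t, (1 <= i)%N -> y i t = theta * y i.-1 t + eps i t.

Local Notation S := (fun m t => gram (y^~ t) m).

(** [s] bounds the variances of the series before time [n], and [A] is a level that
its Gram sum exceeds with high probability. The good event needs [A] to be larger
than [s] by more than the third power of [ln n]. *)
Definition scale_at (C : R) (n : nat) (s A : R) : Prop :=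
  [/\ 0 < s, 1 <= A, C * (n%:R / ln n%:R ^+ 2) <= A / s,
    (forall i (a : R), (i < n)%N ->
      P [set t | (a <= y i t ^+ 2)%R] <= (2 * expR (- (a / (4 * s))))%:E)%E &
    (P [set t | (S n t <= A)%R] <=
      (expR 1 / Num.sqrt (ln n%:R / 2))%:E)%E].

Let sqrt_quot_le (x z : R) : 0 < z -> z <= x ->
  expR 1 / Num.sqrt x <= expR 1 / Num.sqrt z.
Proof.
move=> z0 zx; rewrite ler_wpM2l ?expR_ge0// lef_pV2 ?posrE ?sqrtr_gt0//.
  exact: ler_wsqrtr.
exact: lt_le_trans zx.
Qed.

(** The variances are at most [1 / (1 - theta^2)], and the choice [A = n / ln n] makes
the product of the [n] factors of the Laplace transform small, as each coefficient
is at least [1 / A]. *)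
Lemma stationary_scale : theta != 1 ->
  exists2 C : R, 0 < C & \forall n \near \oo, exists s A, scale_at C n s A.
Proof.
move=> th1; have th2 : 0 < 1 - theta ^+ 2.
  have /andP[a b] := htheta.
  have t1 : theta < 1 by rewrite lt_neqAle th1 b.
  nra.
exists (1 - theta ^+ 2) => //; near=> n.
have l2 : 2 <= ln n%:R :> R by near: n; exact: near_ln_ge.
have n2 : (2 <= n)%N by near: n; exact: nbhs_infty_ge.
have n0 : 0 < n%:R :> R by rewrite ltr0n (leq_trans _ n2).
have n1 : n%:R / 2 <= n.-1%:R :> R.
  have nE : n%:R = n.-1%:R + 1 :> R by rewrite natr1 prednK// (leq_trans _ n2).
  have n11 : 1 <= n.-1%:R :> R by rewrite ler1n -ltnS prednK// (leq_trans _ n2).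
  by rewrite nE; lra.
set l := ln n%:R in l2 *.
have l0 : 0 < l by lra.
have nl : l <= n%:R by rewrite ltW// ln_sublinear.
pose s := (1 - theta ^+ 2)^-1; have s0 : 0 < s by rewrite invr_gt0.
pose A := n%:R / l; have A0 : 0 < A by rewrite divr_gt0.
exists s, A; rewrite /scale_at -/l; split => //.
- by rewrite ler_pdivlMr// mul1r.
- rewrite /s invrK mulrC ler_wpM2r ?(ltW th2)// ler_wpM2l ?(ltW n0)//.
  rewrite lef_pV2 ?posrE ?exprn_gt0// expr2 ler_peMr ?(ltW l0)//.
  by apply: le_trans l2; rewrite ler1n.
- move=> i a _; apply: (@tail_y _ _ _ _ _ eps_indep eps_law theta y y0 yE
    (fun=> s)) => //; first exact: ltW.
  by move=> _; rewrite le_eqVlt; apply/orP; left; apply/eqP; rewrite /s;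
    field; rewrite gt_eqF.
- have lam0 : 0 < A^-1 by rewrite invr_gt0.
  have h j : (1 <= j)%N -> A^-1 <= ball_coef A^-1 theta j.
    by case: j => // j _; apply: ball_coef_ge_lambda; exact: ltW.
  have := small_ball_gram eps_indep eps_law y0 yE lam0 n.-1 (ltW lam0) h.
  rewrite addn1 prednK ?(leq_trans _ n2)// invrK => /le_trans; apply.
  rewrite lee_fin; apply: sqrt_quot_le; first by rewrite divr_gt0.
  have h1 : A^-1 * (n%:R / 2) = l / 2 by rewrite /A; field; rewrite !gt_eqF.
  have h2 : A^-1 * (n%:R / 2) <= A^-1 * n.-1%:R by rewrite ler_wpM2l// ltW.
  rewrite -mulrA; move: h2; rewrite h1; move: (A^-1 * n.-1%:R) => w h2; lra.
Unshelve. all: by end_near. Qed.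

(** The variance at time [i] is [i], and [A = q^2] with [q] just above [n / ln n]: the
coefficients reach [1 / (2 q)] after [q] steps, and the [n - q] remaining steps
contribute a sum of order [ln n]. *)
Lemma unit_root_scale : theta = 1 ->
  exists2 C : R, 0 < C & \forall n \near \oo, exists s A, scale_at C n s A.
Proof.
move=> th1; have th2 : theta ^+ 2 = 1 by rewrite th1 expr1n.
exists 1 => //; near=> n.
have l4 : 4 <= ln n%:R :> R by near: n; exact: near_ln_ge.
have n1 : (1 <= n)%N by near: n; exact: nbhs_infty_ge.
have n0 : 0 < n%:R :> R by rewrite ltr0n.
set l := ln n%:R in l4 *.
have l0 : 0 < l by lra.
have nl : l <= n%:R by rewrite ltW// ln_sublinear.
pose x := n%:R / l; have x0 : 0 < x by rewrite divr_gt0.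
have xl : x * l = n%:R by rewrite /x; field; rewrite gt_eqF.
pose q := (Num.truncn x).+1.
have q0 : (0 < q)%N by [].
have /andP[xq1 xq2] : (Num.truncn x)%:R <= x < q%:R.
  by apply: truncn_itv; exact: ltW.
have Q1 : 1 <= q%:R :> R by rewrite ler1n.
have Q0 : 0 < q%:R :> R by rewrite ltr0n.
have Qx : q%:R <= x + 1 by rewrite -natr1 lerD2r.
have x1 : 1 <= x by rewrite ler_pdivlMr// mul1r.
have qn : (q <= n)%N by rewrite -(@ler_nat R); nra.
pose A : R := q%:R ^+ 2; have A0 : 0 < A by rewrite exprn_gt0.
exists n%:R, A; rewrite /scale_at -/l; split => //.
- by rewrite exprn_ege1.
- rewrite mul1r ler_pdivlMr// mulrAC -expr2 -expr_div_n.
  by rewrite ler_sqr ?nnegrE ?ltW.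
- move=> i a ilt; apply: (@tail_y _ _ _ _ _ eps_indep eps_law theta y y0 yE
    (fun j => j%:R)) => //; last by rewrite ler_nat ltnW.
  by move=> j; rewrite th2 mul1r natr1.
- have lam0 : 0 < A^-1 by rewrite invr_gt0.
  pose cs : R := (2 * q%:R)^-1.
  have cs0 : 0 <= cs by rewrite invr_ge0 mulr_ge0.
  have h j : (q <= j)%N -> cs <= ball_coef A^-1 theta j.
    move=> qj; apply: le_trans (ball_coef_unit_root j th2 q0).
    rewrite (minn_idPr qj) /cs le_eqVlt; apply/orP; left; apply/eqP.
    by field; rewrite gt_eqF.
  have := small_ball_gram eps_indep eps_law y0 yE lam0 (n - q) cs0 h.
  rewrite subnK// invrK => /le_trans; apply.
  rewrite lee_fin; apply: sqrt_quot_le; first by rewrite divr_gt0.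
  rewrite natrB// /cs.
  have -> : 1 + 2 * (2 * q%:R)^-1 * (n%:R - q%:R) = n%:R / q%:R :> R.
    by field; rewrite gt_eqF.
  by rewrite ler_pdivlMr// -xl; nra.
Unshelve. all: by end_near. Qed.

Lemma exists_scale :
  exists2 C : R, 0 < C & \forall n \near \oo, exists s A, scale_at C n s A.
Proof.
have [/unit_root_scale //|] := eqVneq theta 1; exact: stationary_scale.
Qed.

Definition bad_event n : set T :=
  [set t | S n t < 1 \/ exists2 i, (1 <= i <= n)%N &
    S n t / 2 < ln n%:R ^+ 2 * y i.-1 t ^+ 2].

Lemma measurable_bad_event n : measurable (bad_event n).
Proof.
have my i : measurable_fun setT (y i) by exact: (measurable_y y0 yE).
have mS : measurable_fun setT (S n) by exact: (measurable_gram y0 yE).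
have -> : bad_event n = [set t | S n t < 1] `|`
    \bigcup_(i in [set i | (1 <= i <= n)%N])
      [set t | S n t / 2 < ln n%:R ^+ 2 * y i.-1 t ^+ 2].
  by apply/seteqP; split=> t /= [|[i i1 i2]]; [left|right; exists i|left|right; exists i].
apply: measurableU.
  rewrite -[X in measurable X]setTI.
  exact: measurable_fun_ltr.
apply: fin_bigcup_measurable.
  by apply: (@sub_finite_set _ _ `I_n.+1) => // i /= /andP[].
move=> i _; rewrite -[X in measurable X]setTI.
apply: measurable_fun_ltr => //; apply: measurable_funM => //.
exact: measurable_funX.
Qed.

(** If [S > A] then the event requires some [y_i^2] to exceed [A / (2 (ln n)^2)],
which [union_tail_le] with [l = ln n] makes unlikely for all of them at once. *)
Lemma bad_event_small (e : R) : 0 < e ->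
  \forall n \near \oo, (P (bad_event n) <= e%:E)%E.
Proof.
move=> e0; have [C C0 nearC] := exists_scale.
near=> n.
have l1 : 1 <= ln n%:R :> R by near: n; exact: near_ln_ge.
have lC : 2 * 5760 / C <= ln n%:R by near: n; exact: near_ln_ge.
have le1 : 4 / e <= ln n%:R by near: n; exact: near_ln_ge.
have le2 : 2 * (2 * expR 1 / e) ^+ 2 <= ln n%:R by near: n; exact: near_ln_ge.
have n1 : (1 <= n)%N by near: n; exact: nbhs_infty_ge.
have [s [A [s0 A1 CA tail ball]]] : exists s A, scale_at C n s A by near: n.
set l := ln n%:R in l1 lC le1 le2 CA ball *.
have l0 : 0 < l by lra.
have nE : n%:R = expR l by rewrite lnK// posrE ltr0n.
have my i : measurable_fun setT (y i) by exact: (measurable_y y0 yE).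
have mS : measurable_fun setT (S n) by exact: (measurable_gram y0 yE).
pose a := A / (2 * l ^+ 2).
pose B i := [set t | a <= y i t ^+ 2].
have mB i : measurable (B i).
  rewrite -[X in measurable X]setTI.
  by apply: measurable_fun_ler => //; exact: measurable_funX.
have mSA : measurable [set t | S n t <= A].
  by rewrite -[X in measurable X]setTI; apply: measurable_fun_ler.
have sub : bad_event n `<=` [set t | S n t <= A] `|` \big[setU/set0]_(i < n) B i.
  move=> t; have [SA|AS] := leP (S n t) A; first by left.
  move=> [S1|[i /andP[i1 ilen] hi]].
    by exfalso; move: S1; rewrite ltNge (le_trans A1)// ltW.
  right; rewrite -bigcup_mkord; exists i.-1 => /=; first by rewrite prednK.
  rewrite /B /= /a ler_pdivrMr; last by rewrite mulr_gt0// exprn_gt0.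
  by rewrite -/l in hi; nra.
have hb : (P (\big[setU/set0]_(i < n) B i) <= (2 / l)%:E)%E.
  apply: le_trans (Boole_inequality _ _) _ => //.
  apply: (@le_trans _ _ (\sum_(i < n) (2 * expR (- (a / (4 * s))))%:E)%E).
    by apply: lee_sum => i _; exact: tail.
  rewrite sumEFin lee_fin big_const_ord iter_addr_0 -[leLHS]mulr_natl /a nE.
  rewrite nE in CA.
  exact: union_tail_le l1 lC s0 CA.
have mU : measurable (\big[setU/set0]_(i < n) B i) by exact: bigsetU_measurable.
apply: le_trans (le_measure _ _ _ sub) _; rewrite ?inE.
- exact: measurable_bad_event.
- exact: measurableU.
apply: le_trans (measureU2 _ _ _) _ => //.
apply: (@le_trans _ _ ((e / 2)%:E + (e / 2)%:E)%E); last first.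
  by rewrite -EFinD lee_fin; lra.
apply: leeD; [apply: le_trans ball _|apply: le_trans hb _]; rewrite lee_fin.
- rewrite ler_pdivrMr ?sqrtr_gt0 ?divr_gt0//.
  have h : 2 * expR 1 / e <= Num.sqrt (l / 2).
    rewrite -[leLHS]ger0_norm; last first.
      by rewrite divr_ge0 ?mulr_ge0 ?expR_ge0// ltW.
    by rewrite -sqrtr_sqr ler_wsqrtr//; lra.
  have -> : expR 1 = e / 2 * (2 * expR 1 / e) by field; rewrite gt_eqF.
  by rewrite ler_wpM2l// divr_ge0// ltW.
- rewrite ler_pdivrMr//; move: le1; rewrite ler_pdivrMr//; lra.
Unshelve. all: by end_near. Qed.

End good_event.

(** * The limit law *)

Section online_debiasing_law.
Context d (T : measurableType d) (R : realType) (P : probability T R).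
Variable eps : nat -> {RV P >-> R}.
Local Notation N01 := (normal_prob (0 : R) (1 : R)).
Hypothesis eps_indep : mutually_independent [set i : nat | (1 <= i)%N] eps.
Hypothesis eps_law : forall i, (1 <= i)%N -> has_law (eps i) N01.
Variables (theta : R) (y : nat -> T -> R).
Hypothesis htheta : -1 < theta <= 1.
Hypothesis y0 : forall t, y 0%N t = 0.
Hypothesis yE : forall i t, (1 <= i)%N -> y i t = theta * y i.-1 t + eps i t.

Definition od_weight n i t : R :=
  od_w (od_gamma R n) (od_z (od_Gamma (y^~ t) n) (y^~ t)) i.

Definition debiased_error n t : R :=
  Num.sqrt (gram (y^~ t) n / log_loglog R n) *
  (theta_OD (od_gamma R n) (od_Gamma (y^~ t) n) (y^~ t) n - theta).

(** The noise [eps n.+1], which the estimator at time [n] does not involve, supplies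
the variance that the weights leave out. *)
Definition gaussian_proxy n t : R :=
  \sum_(1 <= i < n.+1) (Num.sqrt (od_gamma R n) * od_weight n i t) * eps i t
  + Num.sqrt (1 - \sum_(1 <= i < n.+1)
      (Num.sqrt (od_gamma R n) * od_weight n i t) ^+ 2) * eps n.+1 t.

Let ay i : adapted eps i (y i).
Proof. exact: (adapted_y y0 yE). Qed.
Let my i : measurable_fun setT (y i).
Proof. exact: (measurable_y y0 yE). Qed.
Let mgram m : measurable_fun setT (fun t => gram (y^~ t) m).
Proof. exact: (measurable_gram y0 yE). Qed.

Let theta2 : theta ^+ 2 <= 1.
Proof. by have /andP[a b] := htheta; nra. Qed.

Let adapted_z n i : adapted eps i (fun t => od_z (od_Gamma (y^~ t) n) (y^~ t) i.+1).
Proof.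
apply: measurable_funM; last exact: ay.
apply: (measurableT_comp (@measurable_invr R)).
apply: (measurableT_comp (@measurable_sqrt R)).
apply: measurable_maxr.
  by apply: measurable_funM; [exact: measurable_cst|apply: measurable_funX; exact: ay].
apply: measurable_sum_nat => j /andP[_ ji]; apply: measurable_funX.
by apply: adapted_le (@ay j).
Qed.

Let adapted_wz n i : adapted eps i.-1
  (fun t => od_wz (od_gamma R n) (od_z (od_Gamma (y^~ t) n) (y^~ t)) i).
Proof.
elim: i => [|i IH]; first exact: measurable_cst.
have IH' := adapted_le (leq_pred i) IH.
have az := @adapted_z n i; rewrite /=.
apply: measurable_funD => //; apply: measurable_funM => //.
apply: measurable_funM.
  by apply: measurable_funM => //; apply: measurable_funB => //; exact: measurable_cst.
apply: (measurableT_comp (@measurable_invr R)); apply: measurable_funD.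
  exact: measurable_cst.
exact: measurable_funX.
Qed.

Lemma adapted_od_weight n i : (1 <= i)%N -> adapted eps i.-1 (od_weight n i).
Proof.
case: i => // i _; have az := @adapted_z n i.
have aw := adapted_le (leq_pred i) (@adapted_wz n i).
apply: measurable_funM.
  by apply: measurable_funM => //; apply: measurable_funB => //; exact: measurable_cst.
apply: (measurableT_comp (@measurable_invr R)); apply: measurable_funD.
  exact: measurable_cst.
exact: measurable_funX.
Qed.

Let mw n i : (1 <= i)%N -> measurable_fun setT (od_weight n i).
Proof. by move=> /(@adapted_od_weight n); exact: adapted_measurable. Qed.

Lemma measurable_debiased_error n : measurable_fun setT (debiased_error n).
Proof.
have msq (f : T -> R) : measurable_fun setT f ->
    measurable_fun setT (fun t => Num.sqrt (f t)).
  by move=> mf; exact: (measurableT_comp (@measurable_sqrt R)).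
have minv (f : T -> R) : measurable_fun setT f ->
    measurable_fun setT (fun t => (f t)^-1).
  by move=> mf; exact: (measurableT_comp (@measurable_invr R)).
have mLS : measurable_fun setT (fun t => theta_LS (y^~ t) n).
  apply: measurable_funM; first exact: minv.
  by apply: measurable_sum_nat => i _; exact: measurable_funM.
apply: measurable_funM; first by apply: msq; exact: measurable_funM.
apply: measurable_funB => //; apply: measurable_funD => //.
apply: measurable_funM; first by apply: minv; exact: msq.
apply: measurable_sum_nat => i /andP[i1 _]; apply: measurable_funM.
  exact: mw.
by apply: measurable_funB => //; exact: measurable_funM.
Qed.

Lemma measurable_gaussian_proxy n : measurable_fun setT (gaussian_proxy n).
Proof.
apply: measurable_funD.
  apply: measurable_sum_nat => i /andP[i1 _]; apply: measurable_funM => //.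
  by apply: measurable_funM => //; exact: mw.
apply: measurable_funM => //; apply: (measurableT_comp (@measurable_sqrt R)).
apply: measurable_funB => //; apply: measurable_sum_nat => i /andP[i1 _].
by apply: measurable_funX; apply: measurable_funM => //; exact: mw.
Qed.

Lemma gaussian_proxy_law n : 0 < od_gamma R n ->
  forall A : set R, measurable A -> P (gaussian_proxy n @^-1` A) = N01 A.
Proof.
move=> g0 A mA; apply: (predictable_gaussian_sum eps_indep eps_law) => //.
- move=> i /andP[i1 _]; apply: measurable_funM; first exact: measurable_cst.
  exact: adapted_od_weight.
- by move=> t; exact: sum_od_w_sqr_lt1.
Qed.

Local Notation Q2 := (self_normalized eps y).

(** Off the bad event, [od_error_approx] bounds the squared difference by
[4 gamma Q2] and [2 v eps_(n+1)^2]. With [m = ln (ln n)], both [gamma * ln n] and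
[v] are [O(1 / m)], and Markov's inequality applies to each. *)
Lemma debiased_error_approx (dl e : R) : 0 < dl -> 0 < e ->
  \forall n \near \oo,
  (P [set t | (dl <= `|debiased_error n t - gaussian_proxy n t|)%R] <= e%:E)%E.
Proof.
move=> dl0 e0; have e20 : 0 < e / 2 by rewrite divr_gt0.
near=> n.
have hb : (P (bad_event y n) <= (e / 2)%:E)%E.
  by near: n; exact: (bad_event_small eps_indep eps_law htheta y0 yE).
have m1 : 1 <= ln (ln n%:R) :> R by near: n; exact: near_lnln_ge.
(* 1008 is twice the sum of the constants 432 and 72 in the two bounds below. *)
have mB : 1008 / (dl ^+ 2 * e) <= ln (ln n%:R) by near: n; exact: near_lnln_ge.
have l1 : 1 <= ln n%:R :> R by near: n; exact: near_ln_ge.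
have n1 : (1 <= n)%N by near: n; exact: nbhs_infty_ge.
set l : R := ln n%:R in m1 mB l1.
set m : R := ln l in m1 mB.
have l0 : 0 < l by lra.
have m0 : 0 < m by lra.
have dl20 : 0 < dl ^+ 2 by rewrite exprn_gt0.
have lE : l = expR m by rewrite lnK.
have lm : m ^+ 2 / 2 <= l.
  by rewrite lE; have := expR_ge1Dxn 1 (ltW m0); rewrite (_ : 2`! = 2)%N//; lra.
have gE : od_gamma R n = (l * m)^-1 by [].
have g0 : 0 < od_gamma R n by rewrite gE invr_gt0 mulr_gt0.
have gm : od_gamma R n <= m^-1.
  by rewrite gE lef_pV2 ?posrE ?mulr_gt0// ler_peMl// ltW.
pose v := od_gamma R n ^+ 2 + (l ^+ 2)^-1 / od_gamma R n.
have v0 : 0 < v.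
  apply: ltr_wpDr; last exact: exprn_gt0.
  by apply: divr_ge0; [rewrite invr_ge0 sqr_ge0|exact: ltW].
have vm : v <= 3 / m.
  have h1 : od_gamma R n ^+ 2 <= m^-1.
    rewrite expr2; apply: (le_trans _ gm); rewrite ler_piMl ?(ltW g0)//.
    by rewrite (le_trans gm)// invf_le1.
  have h2 : (l ^+ 2)^-1 / od_gamma R n <= 2 / m.
    rewrite gE invrK; have -> : (l ^+ 2)^-1 * (l * m) = m / l.
      by field; rewrite gt_eqF.
    by rewrite ler_pdivlMr// mulrAC ler_pdivrMr// -expr2; lra.
  by rewrite (_ : 3 / m = m^-1 + 2 / m) ?lerD//; field; rewrite gt_eqF.
(* Off [E1] and [E2], each of the two terms of the bound is below [dl ^+ 2 / 2]. *)
pose E1 := [set t | dl ^+ 2 / (8 * od_gamma R n) <= Q2 n t].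
pose E2 := [set t | dl ^+ 2 / (4 * v) <= eps n.+1 t ^+ 2].
have mQ2 : measurable_fun setT (Q2 n) by exact: (measurable_self_normalized y0 yE).
have mE1 : measurable E1.
  by rewrite -[X in measurable X]setTI; apply: measurable_fun_ler.
have me2 : measurable_fun setT (fun t => eps n.+1 t ^+ 2) by exact: measurable_funX.
have mE2 : measurable E2.
  by rewrite -[X in measurable X]setTI; apply: measurable_fun_ler.
have mBad : measurable (bad_event y n) by exact: (measurable_bad_event y0 yE).
have sub : [set t | dl <= `|debiased_error n t - gaussian_proxy n t|] `<=`
    bad_event y n `|` (E1 `|` E2).
  move=> t /= hdl; have [|good] := pselect (bad_event y n t); first by left.
  right; have S1 : 1 <= gram (y^~ t) n.
    by rewrite leNgt; apply/negP => S1; apply: good; left.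
  have small i : (1 <= i <= n)%N -> l ^+ 2 * y i.-1 t ^+ 2 <= gram (y^~ t) n / 2.
    move=> i1n; rewrite leNgt; apply/negP => h; apply: good; right.
    by exists i.
  have S0 : 0 < gram (y^~ t) n by exact: lt_le_trans S1.
  have := @od_error_approx R theta (y^~ t) (fun i => eps i t) n (y0 t)
    (fun i => @yE i t) S0 l0 g0 small S1 v (lexx v).
  rewrite /= -/(debiased_error n t) -/(gaussian_proxy n t) -/(Q2 n t).
  set Del := debiased_error n t - _ in hdl *.
  have Dsq : dl ^+ 2 <= Del ^+ 2.
    by rewrite -[leRHS]real_normK ?num_real// ler_sqr ?nnegrE ?(ltW dl0)// (le_trans (ltW dl0)).
  move=> hD; rewrite /E1 /E2 /=.
  have [q1|q1] := leP (dl ^+ 2 / (8 * od_gamma R n)) (Q2 n t); first by left.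
  right; rewrite ler_pdivrMr ?mulr_gt0//.
  move: q1; rewrite ltr_pdivlMr ?mulr_gt0// => q1.
  have -> : eps n.+1 t ^+ 2 * (4 * v) = 2 * (2 * (v * eps n.+1 t ^+ 2)) by ring.
  have h8 : Q2 n t * (8 * od_gamma R n) = 2 * (4 * (od_gamma R n * Q2 n t)) by ring.
  by rewrite h8 in q1; lra.
have md0 : 0 < m * dl ^+ 2 by rewrite mulr_gt0.
have hE1 : (P E1 <= (432 / (m * dl ^+ 2))%:E)%E.
  have c0 : 0 < dl ^+ 2 / (8 * od_gamma R n) by rewrite divr_gt0// mulr_gt0.
  have := ge0_markov mQ2 (self_normalized_ge0 eps y n) c0
    (mean_self_normalized eps_indep eps_law theta2 y0 yE n1).
  move=> /le_trans; apply; rewrite lee_fin gE -/l.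
  have -> : (12 * l + 42) / (dl ^+ 2 / (8 * (l * m)^-1)) =
    8 * ((12 * l + 42) / l) / (m * dl ^+ 2) by field; rewrite !gt_eqF.
  rewrite ler_wpM2r ?invr_ge0 ?(ltW md0)//.
  have : (12 * l + 42) / l <= 54 by rewrite ler_pdivrMr//; lra.
  lra.
have hE2 : (P E2 <= (72 / (m * dl ^+ 2))%:E)%E.
  have c0 : 0 < dl ^+ 2 / (4 * v) by rewrite divr_gt0// mulr_gt0.
  have e2 : (\int[P]_t (eps n.+1 t ^+ 2)%:E <= 6%:E)%E.
    have a0 : adapted eps n (fun=> 0 : R) by exact: measurable_cst.
    have a1 : adapted eps n (fun=> 1 : R) by exact: measurable_cst.
    have := adapted_second_moment eps_indep eps_law a0 a1.
    rewrite expr0n expr1n add0r mulr1 integral_cst//= probability_setT mule1.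
    apply: le_trans; rewrite le_eqVlt; apply/orP; left; apply/eqP.
    by apply: eq_integral => t _; rewrite add0r mul1r.
  have := ge0_markov me2 (fun t => sqr_ge0 _) c0 e2.
  move=> /le_trans; apply; rewrite lee_fin.
  have -> : 6 / (dl ^+ 2 / (4 * v)) = 24 * v / dl ^+ 2.
    by field; rewrite !gt_eqF.
  have -> : 72 / (m * dl ^+ 2) = 24 * (3 / m) / dl ^+ 2 by field; rewrite !gt_eqF.
  by rewrite ler_wpM2r ?invr_ge0 ?(ltW dl20)// ler_wpM2l.
apply: le_trans (le_measure _ _ _ sub) _; rewrite ?inE.
- rewrite -[X in measurable X]setTI; apply: measurable_fun_ler => //.
  apply: measurableT_comp => //; apply: measurable_funB.
    exact: measurable_debiased_error.
  exact: measurable_gaussian_proxy.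
- by apply: measurableU => //; exact: measurableU.
apply: le_trans (measureU2 _ _ _) _ => //; first exact: measurableU.
apply: (@le_trans _ _ ((e / 2)%:E + (e / 2)%:E)%E); last first.
  by rewrite -EFinD lee_fin; lra.
apply: leeD => //; apply: le_trans (measureU2 _ _ _) _ => //.
apply: le_trans (leeD hE1 hE2) _; rewrite -EFinD lee_fin -mulrDl.
rewrite ler_pdivrMr ?mulr_gt0//.
move: mB; rewrite ler_pdivrMr ?mulr_gt0//; lra.
Unshelve. all: by end_near. Qed.

End online_debiasing_law.

Unset Implicit Arguments.

Theorem corollary2 (R : realType) (d : measure_display) (T : measurableType d)
    (P : probability T R) (theta : R) (eps : nat -> {RV P >-> R})
    (y : nat -> T -> R)
    (htheta : -1 < theta <= 1)
    (eps_indep : mutually_independent [set i : nat | (1 <= i)%N] eps)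
    (eps_law : forall i : nat, (1 <= i)%N ->
       has_law (eps i) (normal_prob (0 : R) (1 : R)))
    (y0 : forall t : T, y 0%N t = 0)
    (yE : forall (i : nat) (t : T), (1 <= i)%N ->
       y i t = theta * y i.-1 t + eps i t) :
  cvg_in_distribution P
    (fun (n : nat) (t : T) =>
       let yt := fun i : nat => y i t in
       Num.sqrt ((\sum_(1 <= i < n.+1) yt i.-1 ^+ 2) / log_loglog R n)
       * (theta_OD (od_gamma R n) (od_Gamma yt n) yt n - theta))
    (normal_prob (0 : R) (1 : R)).
Proof.
apply: (@cvg_in_distribution_approx _ _ _ _ (debiased_error theta y)
  (gaussian_proxy eps y)).
- exact: (measurable_debiased_error y0 yE).
- exact: (measurable_gaussian_proxy y0 yE).
- near=> n; apply: (gaussian_proxy_law eps_indep eps_law y0 yE).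
  have l1 : 1 <= ln n%:R :> R by near: n; exact: near_ln_ge.
  have m1 : 1 <= ln (ln n%:R) :> R by near: n; exact: near_lnln_ge.
  by rewrite invr_gt0 mulr_gt0//; [exact: lt_le_trans l1|exact: lt_le_trans m1].
- exact: (debiased_error_approx eps_indep eps_law htheta y0 yE).
Unshelve. all: by end_near. Qed.
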